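(* Let $X$ be a flag simplicial complex triangulating $S^5$. Assume $X$ has an edge $\eta$ whose link $\mathrm{Lk}_\eta$ is a cross-polytope, and that $h_X(-1)<0$ (equivalently, the coefficient of $t^3$ in $\gamma_X$ is positive). Then for every sufficiently large natural number $m$, the h-polynomial of the $m$-fold subdivision $\mathrm{Sub}^m_\eta(X)$ has a non-real root.
   Context: Simplicial complexes contain the empty face; $\#\sigma$ is the number of vertices of $\sigma$. Link: $\mathrm{Lk}_\sigma=\{\tau\in X:\sigma\cup\tau\in X,\ \sigma\cap\tau=\emptyset\}$. Flag: every set of pairwise adjacent vertices is a face. The join of complexes $X,Y$ on disjoint vertex sets is $\{\sigma\cup\tau:\sigma\in X,\tau\in Y\}$; the $k$-dimensional cross-polytope is the $(k+1)$-fold join of the complex consisting of two vertices and no edge. f-polynomial: $f_X(t)=\sum_{\sigma\in X}t^{\#\sigma}$; for $X$ a triangulation of $S^{n-1}$, $h_X$ is defined by $(1+t)^n h_X(\frac1{1+t})=t^nf_X(\frac1t)$, and $\gamma_X$ is the unique polynomial with $h_X(t)=(1+t)^{n}\gamma_X\!\left(\frac{t}{(1+t)^2}\right)$. Edge subdivision: for an edge $\eta=\{s,t\}$ of $X$ and a new vertex $e$, $\mathrm{Sub}_\eta(X)=\{\sigma:\eta\not\subset\sigma\in X\}\cup\{\sigma\cup\{e\},\sigma\cup\{s,e\},\sigma\cup\{t,e\}:\sigma\in\mathrm{Lk}_\eta\}$. The $m$-fold subdivision $\mathrm{Sub}^m_\eta(X)$ is obtained by $m$ successive edge subdivisions, the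 first along $\eta$ and each subsequent one along an edge joining the most recently added vertex to an endpoint of the previously subdivided edge (such an edge has link equal to $\mathrm{Lk}_\eta$). *)

(* Defs.v *)
From HB Require Import structures.
From mathcomp Require Import all_boot all_order all_algebra all_field.
From mathcomp Require Import finmap.
From mathcomp Require Import all_classical all_reals all_analysis.
From mathcomp Require Import Rstruct Rstruct_topology.
Set Implicit Arguments. Unset Strict Implicit. Unset Printing Implicit Defensive.
Import Order.TTheory GRing.Theory Num.Theory.

Definition complex := {fset {fset nat}}.

Local Open Scope fset_scope.

Definition is_simplicial_complex (X : complex) : Prop :=
  fset0 \in X /\ forall s t : {fset nat}, s \in X -> t `<=` s -> t \in X.

Definition is_vertex (X : complex) (v : nat) : bool := [fset v] \in X.

Definition is_flag (X : complex) : Prop :=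
  forall S : {fset nat},
    (forall v, v \in S -> is_vertex X v) ->
    (forall u v, u \in S -> v \in S -> u != v -> [fset u; v] \in X) ->
    S \in X.

Definition link (X : complex) (s : {fset nat}) : complex :=
  [fset t in X | (s `|` t \in X) && (s `&` t == fset0)].

Definition is_edge (X : complex) (e : {fset nat}) : bool :=
  (e \in X) && (#|` e| == 2).

Definition edge_sub (X : complex) (eta : {fset nat}) (e : nat) : complex :=
  [fset s in X | ~~ (eta `<=` s)]
  `|` [fset s `|` [fset e] | s in link X eta]
  `|` [fset s `|` [fset x; e] | s in link X eta, x in eta].

Definition fresh (X : complex) (e : nat) : bool :=
  all (fun s : {fset nat} => e \notin s) X.

(* m-fold subdivision (m >= 1): [msub X eta m Y eps e] means that Y is an
   m-fold subdivision Sub^m_eta(X), eps being the last subdivided edge and e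
   the most recently added vertex.  The first subdivision is along eta; each
   subsequent one is along the edge joining the most recently added vertex to
   an endpoint of the previously subdivided edge. All choices (new vertex
   names, endpoints) are allowed. *)
Inductive msub (X : complex) (eta : {fset nat}) :
    nat -> complex -> {fset nat} -> nat -> Prop :=
| msub_one e : fresh X e -> msub X eta 1 (edge_sub X eta e) eta e
| msub_succ m Y eps e u e' :
    msub X eta m Y eps e -> u \in eps -> fresh Y e' ->
    msub X eta m.+1 (edge_sub Y [fset e; u] e') [fset e; u] e'.

(* Y is a cross-polytope: (up to vertex names) the join of k+1 copies of the
   complex with two vertices and no edge, i.e. vertices are k+1 disjoint pairs
   {a_i, b_i} and the faces are the vertex sets containing no pair. *)
Definition is_cross_polytope (Y : complex) : Prop :=
  exists a b : seq nat,
    size a = size b /\ uniq (a ++ b) /\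
    forall s : {fset nat},
      s \in Y <->
      ((forall v, v \in s -> v \in a ++ b) /\
       forall i, i < size a -> ~ (nth 0 a i \in s /\ nth 0 b i \in s)).

Local Close Scope fset_scope.

Local Open Scope ring_scope.

Definition fpoly (X : complex) : {poly int} :=
  \sum_(s <- X) 'X^(#|` s|).

(* h-polynomial of a triangulation of S^{n-1}: the unique polynomial with
   (1+t)^n h(1/(1+t)) = t^n f(1/t), i.e. h(t) = Σ_{σ∈X} t^{#σ}(1-t)^{n-#σ}. *)
Definition hpoly (n : nat) (X : complex) : {poly int} :=
  \sum_(s <- X) 'X^(#|` s|) * (1 - 'X) ^+ (n - #|` s|).

Definition has_nonreal_root (p : {poly int}) : Prop :=
  exists z : algC, root (map_poly intr p) z /\ z \isn't Num.real.

Local Close Scope ring_scope.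

Local Open Scope classical_set_scope.
Local Open Scope ring_scope.

Definition vbound (X : complex) : nat :=
  (\max_(s <- X) \max_(x <- s) x.+1)%N.

Definition realization (X : complex) : set 'rV[Rdefinitions.R]_(vbound X) :=
  [set p | exists2 s, s \in X &
     [/\ (forall i : 'I_(vbound X), (val i \notin s)%fset -> p 0 i = 0),
         (forall i : 'I_(vbound X), 0 <= p 0 i) &
         \sum_(i : 'I_(vbound X) | (val i \in s)%fset) p 0 i = 1]].

Arguments realization : clear implicits.

Definition sphere (d : nat) : set 'rV[Rdefinitions.R]_d.+1 :=
  [set v | \sum_(i < d.+1) v 0 i ^+ 2 = 1].

Arguments sphere : clear implicits.

Definition homeomorphic {T U : topologicalType} (A : set T) (B : set U) : Prop :=
  exists (f : T -> U) (g : U -> T),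
    [/\ {within A, continuous f}, {within B, continuous g},
        (forall x, A x -> B (f x)), (forall y, B y -> A (g y)) &
        (forall x, A x -> g (f x) = x) /\ (forall y, B y -> f (g y) = y)].

Definition triangulates_sphere (X : complex) (d : nat) : Prop :=
  is_simplicial_complex X /\ homeomorphic (realization X) (sphere d).

(* Main.v *)
Require Import Defs.
From HB Require Import structures.
From mathcomp Require Import all_boot all_order all_algebra all_field.
From mathcomp Require Import finmap.
From mathcomp Require Import all_classical all_reals all_analysis.
From mathcomp Require Import Rstruct Rstruct_topology.
From mathcomp Require Import ring lra zify.
Set Implicit Arguments. Unset Strict Implicit. Unset Printing Implicit Defensive.
Import Order.TTheory GRing.Theory Num.Theory.
Import numFieldNormedType.Exports.

(* Let k be the number of pairs of antipodal vertices of the link of eta.  Every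
   subdivision step adds the same polynomial D to the h-polynomial, so that
   h(Sub^m X) = h_X + m D, with D = t (1-t)^(4-k) (1+t)^k when k <= 4.

   Topology is only needed to exclude k <= 1: then the open star of eta embeds in
   the plane, whereas it is homeomorphic to an open subset of S^5, and Borsuk-Ulam
   forbids an injective continuous map from a 2-sphere in S^5 to the plane.

   For 2 <= k <= 4, D vanishes to order k at -1 while h_X(-1) < 0; the power sums
   of the reciprocals of the roots, taken at -1, of a real-rooted polynomial
   satisfy p_2 >= 0, p_4 >= 0 and p_3^2 <= p_2 p_4, one of which fails for large m.
   For k >= 5 (where D is distorted by the truncated exponents of hpoly), the same
   inequalities at 0 show that D itself has a non-real root, and a non-real root of
   D persists in h_X + m D for large m. *)

Local Open Scope ring_scope.

(** * Real-rooted polynomials *)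

Section PowerSums.
Variable R : comNzRingType.
Implicit Types p : {poly R}.

(* If [p = a * \prod_i (1 + x_i t)], then [psumN p] is [a ^+ N * \sum_i x_i ^+ N], and
   [hankel p x y] is [\sum_i (a x x_i + a^2 y x_i^2)^2]. *)
Definition psum2 p : R := p`_1 ^+ 2 - 2 * p`_0 * p`_2.
Definition psum3 p : R := p`_1 ^+ 3 - 3 * p`_0 * p`_1 * p`_2 + 3 * p`_0 ^+ 2 * p`_3.
Definition psum4 p : R :=
  p`_1 ^+ 4 - 4 * p`_0 * p`_1 ^+ 2 * p`_2 + 2 * p`_0 ^+ 2 * p`_2 ^+ 2
  + 4 * p`_0 ^+ 2 * p`_1 * p`_3 - 4 * p`_0 ^+ 3 * p`_4.
Definition hankel p (x y : R) : R :=
  psum2 p * x ^+ 2 + 2 * psum3 p * x * y + psum4 p * y ^+ 2.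

(** Writing [X - r = -r (1 - X / r)], the new factor multiplies [a] by [-r] and adds the parameter
    [-1/r], whose square is the last term. Being a polynomial identity, it also covers [r = 0] and a
    zero constant coefficient. *)
Lemma hankel_mulXsubC p (r x y : R) :
  hankel (p * ('X - r%:P)) x y
  = hankel p (- r * x) (r ^+ 2 * y) + (p`_0 * x + p`_0 ^+ 2 * y) ^+ 2.
Proof.
by rewrite /hankel /psum2 /psum3 /psum4 mulrBr !coefB !coefMX !coefMC /=; ring.
Qed.

Lemma hankelZ p c x y : hankel (c *: p) x y = hankel p (c * x) (c ^+ 2 * y).
Proof. by rewrite /hankel /psum2 /psum3 /psum4 !coefZ; ring. Qed.

End PowerSums.

Lemma hankel_map_intr (p : {poly int}) (x y : int) :
  hankel (map_poly intr p : {poly algC}) x%:~R y%:~R = (hankel p x y)%:~R.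
Proof.
rewrite /hankel /psum2 /psum3 /psum4 !coef_map /=.
ring.
Qed.

Lemma nonreal_root_or_splits (p : {poly int}) :
  has_nonreal_root p \/
  exists2 rs : seq algC, {in rs, forall r, r \is Num.real} &
    exists2 c : algC, c \is Num.real &
      map_poly intr p = c *: \prod_(r <- rs) ('X - r%:P).
Proof.
have [rs Ep] : exists rs : seq algC, map_poly intr p
    = lead_coef (map_poly intr p : {poly algC}) *: \prod_(r <- rs) ('X - r%:P).
  by have [rs] := closed_field_poly_normal (map_poly intr p : {poly algC}); exists rs.
have [/allP rs_real|/allPn [z z_rs z_nreal]] := boolP (all [in Num.real] rs).
  right; exists rs => //; exists (lead_coef (map_poly intr p)) => //.
  by rewrite lead_coefE coef_map /= realz.
left; exists z; split=> //; rewrite Ep rootE hornerZ.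
have /rootP -> : root (\prod_(r <- rs) ('X - r%:P)) z by rewrite root_prod_XsubC.
by rewrite mulr0.
Qed.

(** Every real root contributes the square of a real number. This single quadratic form packages the
    three inequalities between power sums. *)
Lemma hankel_ge0 (p : {poly int}) (x y : int) :
  ~ has_nonreal_root p -> 0 <= hankel p x y.
Proof.
have [|[rs rs_real [c c_real Ep]]] := nonreal_root_or_splits p => // _.
rewrite -(ler0z algC) -hankel_map_intr Ep hankelZ.
have: c * x%:~R \is Num.real by rewrite realM ?realz.
have: c ^+ 2 * y%:~R \is Num.real by rewrite realM ?realX ?realz.
(* The induction rescales [x] and [y] by the roots, so they must range over all real elements of
   [algC]; the leading coefficient is absorbed at the same time. *)
move: (c * _) (c ^+ 2 * _) => {}y {}x yR xR.
elim: rs rs_real x y xR yR {Ep} => [|r rs IHrs] rs_real x y xR yR.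
  rewrite big_nil /hankel /psum2 /psum3 /psum4 !coef1 /=.
  by rewrite !(mulr0, expr0n, mul0r, addr0, subrr).
have rR : r \is Num.real by apply: rs_real; rewrite mem_head.
have rsR : {in rs, forall r, r \is Num.real}.
  by move=> s s_rs; apply: rs_real; rewrite in_cons s_rs orbT.
have coef0R : (\prod_(r <- rs) ('X - r%:P))`_0 \is Num.real.
  rewrite -horner_coef0 horner_prod big_seq; apply: rpred_prod => s /rsR sR.
  by rewrite hornerXsubC sub0r rpredN.
rewrite big_cons mulrC hankel_mulXsubC addr_ge0 ?IHrs //.
- by rewrite realM ?rpredN.
- by rewrite realM ?realX.
- by rewrite real_exprn_even_ge0 // rpredD ?realM ?realX.
Qed.

(** Allows an expansion at [-1] to be studied at [0], where the Hankel form reads coefficients. *)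
Lemma has_nonreal_root_comp (p : {poly int}) (a : int) :
  has_nonreal_root (p \Po ('X + a%:P)) -> has_nonreal_root p.
Proof.
move=> [z [z_root z_nreal]]; exists (z + a%:~R); split.
  move: z_root; rewrite map_comp_poly /= rmorphD /= map_polyX map_polyC /=.
  by rewrite root_comp hornerD hornerX hornerC.
by rewrite rpredDr // realz.
Qed.

Lemma nonreal_root_affine (p : nat -> {poly int}) (x y a b : int) :
  0 < b -> (forall m, hankel (p m) x y = a - b * m%:Z) ->
  exists M : nat, forall m : nat, (M <= m)%N -> has_nonreal_root (p m).
Proof.
move=> b_gt0 Ep; exists `|a|.+1 => m le_am.
apply: contrapT => /(hankel_ge0 x y); rewrite Ep => ?.
nia.
Qed.

(** For [k = 2] and [k = 4] the form is taken at [(1, 0)] and [(0, 1)]: [psum2], respectively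
    [psum4], is affine in [m] with negative slope. For [k = 3] the slope at [(x, 1)] is [2 A x + B],
    made negative by taking for [x] a large multiple of [-A]. *)
Lemma nonreal_root_perturb (k : nat) (h E : {poly int}) :
  (2 <= k <= 4)%N -> 0 < h`_0 * E`_0 ->
  exists M : nat, forall m : nat, (M <= m)%N ->
    has_nonreal_root (h + (E * 'X^k) *+ m).
Proof.
have coefE (j m : nat) : (h + (E * 'X^k) *+ m)`_j
    = h`_j + m%:Z * (if (j < k)%N then 0 else E`_(j - k)).
  by rewrite coefD coefMn coefMXn -mulr_natl natz.
case: k coefE => [|[|[|[|[|k]]]]] // coefE _ hE.
- apply: (@nonreal_root_affine _ 1 0 (h`_1 ^+ 2 - 2 * h`_0 * h`_2)
    (2 * (h`_0 * E`_0))); first by rewrite pmulr_rgt0.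
  by move=> m; rewrite /hankel /psum2 !coefE /=; ring.
- pose A := 3 * h`_0 ^+ 2 * E`_0.
  pose B := 4 * h`_0 ^+ 2 * h`_1 * E`_0 - 4 * h`_0 ^+ 3 * E`_1.
  (* psum3 grows like A m and psum4 like B m, while psum2 does not depend on m *)
  apply: (@nonreal_root_affine _ (- A * (`|B| + 1)) 1
    (hankel h (- A * (`|B| + 1)) 1) (2 * A ^+ 2 * (`|B| + 1) - B)).
    have A_neq0 : A != 0.
      by rewrite /A; apply: contraTneq hE => ?; nia.
    have : 1 <= A ^+ 2 by nia.
    nia.
  by move=> m; rewrite /hankel /psum2 /psum3 /psum4 !coefE /= -/A -/B /A /B; ring.
- apply: (@nonreal_root_affine _ 0 1 (psum4 h) (4 * h`_0 ^+ 2 * (h`_0 * E`_0))).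
    by nia.
  by move=> m; rewrite /hankel /psum2 /psum3 /psum4 !coefE /=; ring.
Qed.

(** For real [r] the squared modulus of [a + i b - r] is [(a - r)^2 + b^2], so each factor grows
    with the modulus of [b]. *)
Lemma real_rooted_norm_le (p : {poly int}) (a b c : algC) :
  ~ has_nonreal_root p ->
  a \is Num.real -> b \is Num.real -> c \is Num.real -> `|b| <= `|c| ->
  `|(map_poly intr p).[a + 'i * b]| <= `|(map_poly intr p).[a + 'i * c]|.
Proof.
have [|[rs rs_real [d d_real ->]]] := nonreal_root_or_splits p => //.
move=> _ aR bR cR le_bc; rewrite !hornerZ !normrM ler_wpM2l //.
rewrite !horner_prod !normr_prod big_seq [leRHS]big_seq.
apply: ler_prod => r /rs_real rR; rewrite normr_ge0 /= !hornerXsubC.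
rewrite ![_ + _ - r]addrAC -(@ler_pXn2r _ 2) ?nnegrE // !normC2_rect ?rpredB //.
by rewrite lerD2l -(real_normK bR) -(real_normK cR) ler_pXn2r ?nnegrE.
Qed.

(** Compare the root [z] of [D] with a point [w] of the same real part, closer to the real axis,
    where [D(w)] is nonzero. If [h + m D] were real-rooted, then [|h(w) + m D(w)| <= |h(z)|], which
    bounds [m]. *)
Lemma nonreal_root_dominant (D h : {poly int}) :
  D != 0 -> has_nonreal_root D ->
  exists M : nat, forall m : nat, (M <= m)%N -> has_nonreal_root (h + D *+ m).
Proof.
pose DC : {poly algC} := map_poly intr D; pose hC : {poly algC} := map_poly intr h.
move=> D_neq0 [z [z_root z_nreal]]; pose a := 'Re z; pose b := 'Im z.
have b_neq0 : b != 0 by apply: contraNneq z_nreal => b0; apply/Creal_ImP.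
have DC_neq0 : DC != 0.
  by rewrite map_poly_eq0_id0 // intr_eq0 lead_coef_eq0.
(* Infinitely many candidates for [w], of which only finitely many are roots of [D]. *)
pose w n := a + 'i * (b / n.+1%:R).
have w_inj : injective w.
  move=> m n /addrI /(mulfI (neq0Ci _)) /(mulfI b_neq0) /invr_inj /eqP.
  by rewrite eqr_nat eqSS => /eqP.
have [n Dw_neq0] : exists n, DC.[w n] != 0.
  apply: contrapT => /forallNP all_root.
  have := @max_poly_roots _ DC (map w (iota 0 (size DC))) DC_neq0.
  rewrite size_map size_iota ltnn map_inj_uniq // iota_uniq => E.
  suff : false by []; apply: E => //; apply/allP => _ /mapP[n _ ->].
  by rewrite rootE; apply/negPn/negP/all_root.
pose B := (`|hC.[z]| + `|hC.[w n]|) / `|DC.[w n]|.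
have B_ge0 : 0 <= B by rewrite divr_ge0 ?addr_ge0.
exists (Num.bound B) => m le_Bm; apply: contrapT => real_rooted.
have wz : `|b / n.+1%:R| <= `|b|.
  by rewrite normrM normfV ler_piMr // invf_le1 ?normr_gt0 ?pnatr_eq0 // normr_nat ler1n.
have := real_rooted_norm_le real_rooted (Creal_Re z) _ (Creal_Im z) wz.
rewrite -/a -/b -/(w n) -Crect rmorphD rmorphMn /= !hornerD !hornerMn -/DC -/hC.
rewrite (rootP z_root) mul0rn addr0 => /(_ _)/wrap[|le_w].
  by rewrite rpredM ?Creal_Im // rpredV realn.
have : B * `|DC.[w n]| < m%:R * `|DC.[w n]|.
  rewrite ltr_pM2r ?normr_gt0 //; apply: lt_le_trans (archi_boundP B_ge0) _.
  by rewrite ler_nat.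
rewrite /B divfK ?normr_eq0 // mulr_natl -normrMn => lt_w.
have : `|DC.[w n] *+ m| <= `|hC.[z]| + `|hC.[w n]|.
  rewrite -[_ *+ m](addKr hC.[w n]) addrC; apply: le_trans (ler_normB _ _) _.
  by rewrite lerD2r.
by move=> /(lt_le_trans lt_w); rewrite ltxx.
Qed.

(** * The polynomial added to the h-polynomial by one subdivision *)

Section CrossSum.
Variables (V : nmodType) (F : nat -> V).

(* The sum of [F (j + #|` s|)] over the faces [s] of the join of [k] pairs of points. *)
Fixpoint cross_sum (k j : nat) : V :=
  if k is k'.+1 then cross_sum k' j + cross_sum k' j.+1 *+ 2 else F j.

End CrossSum.

Definition hterm (n j : nat) : {poly int} := 'X^j * (1 - 'X) ^+ (n - j).

(** Net contribution of a link face with [j] vertices: its join with the edge is lost, its joins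
    with [{e}], [{s, e}] and [{t, e}] are gained. *)
Definition edge_term (n j : nat) : {poly int} := hterm n j.+1 + hterm n j.+2.

(** The two terms of [edge_term] add up to [X^(j+1) (1 - X)^(4-j)]; then each pair of vertices turns
    one factor [1 - X] into [(1 - X) + 2 X = 1 + X]. *)
Lemma cross_sum_edge_term (k j : nat) : (j + k <= 4)%N ->
  cross_sum (edge_term 6) k j
  = 'X^(j.+1) * (1 - 'X) ^+ (4 - (j + k)) * (1 + 'X) ^+ k.
Proof.
elim: k j => [|k IHk] j le_jk4 /=.
  rewrite addn0 /edge_term /hterm (_ : 6 - j.+1 = (4 - j).+1)%N; last by lia.
  rewrite (_ : 6 - j.+2 = 4 - j)%N; last by lia.
  move: (4 - j)%N => n; rewrite !exprS expr0; ring.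
rewrite !IHk; [|lia..].
rewrite (_ : 4 - (j + k) = (4 - (j + k.+1)).+1)%N; last by lia.
by rewrite addSnnS; move: (4 - _)%N => n; rewrite !exprS; ring.
Qed.

(* Modulo t^6 the truncated exponents of [hterm 6] do not matter, and the closed form
   of [cross_sum_edge_term] holds for all [k] after clearing the denominator. *)
Lemma cross_sum_edge_term_modXn (k j : nat) : exists q : {poly int},
  (1 - 'X) ^+ k * cross_sum (edge_term 6) k j
  = 'X^(j.+1) * (1 - 'X) ^+ (4 - j) * (1 + 'X) ^+ k + 'X^6 * q.
Proof.
elim: k j => [|k IHk] j.
  case: (leqP j 4) => [le_j4|gt_j4] /=.
    exists 0; have := @cross_sum_edge_term 0 j; rewrite addn0 /= => -> //.
    by rewrite !expr0 mulr0 addr0 mul1r.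
  (* For [j >= 5] everything is a multiple of [X^6]; writing [j = i + 5] exposes that factor. *)
  have -> : j = (j - 5 + 5)%N by lia.
  move: (j - 5)%N => i; rewrite /edge_term /hterm.
  exists ('X^i * (1 - 'X) ^+ (6 - (i + 5).+1) + 'X^(i.+1) * (1 - 'X) ^+ (6 - (i + 5).+2)
          - 'X^i * (1 - 'X) ^+ (4 - (i + 5))).
  rewrite !expr0; move: (6 - _)%N (6 - _)%N (4 - _)%N => a b c; rewrite !exprS !exprD !exprS; ring.
have [q Eq] := IHk j; have [q' Eq'] := IHk j.+1.
have -> : (1 - 'X) ^+ k.+1 * cross_sum (edge_term 6) k.+1 j =
    (1 - 'X) * ((1 - 'X) ^+ k * cross_sum (edge_term 6) k j
             + ((1 - 'X) ^+ k * cross_sum (edge_term 6) k j.+1) *+ 2) :> {poly int}.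
  by rewrite /= exprS; ring.
rewrite {}Eq {}Eq'; case: (ltngtP j 4) => [lt_j4|gt_j4|->].
- exists ((1 - 'X) * (q + q' *+ 2)).
  rewrite (_ : 4 - j = (4 - j.+1).+1)%N; last by lia.
  by move: (4 - _)%N => n; rewrite !exprS; ring.
- have -> : j = (j - 5 + 5)%N by lia.
  move: (j - 5)%N => i.
  have -> : (4 - (i + 5) = 0)%N by lia.
  have -> : (4 - (i + 5).+1 = 0)%N by lia.
  exists ((1 - 'X) * (q + q' *+ 2)
    + 'X^i * (1 + 'X) ^+ k * ((1 - 'X) * (1 + 'X *+ 2) - (1 + 'X))).
  rewrite !exprS !exprD !exprS; ring.
(* At [j = 4] the exponent [4 - j] can drop no further, but [(1 - X) (1 + 2 X) = 1 + X - 2 X^2] and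
   the error [- 2 X^2] is multiplied by [X^5]. *)
- exists ((1 - 'X) * (q + q' *+ 2) - ('X * (1 + 'X) ^+ k) *+ 2).
  rewrite !subnn !exprS !expr0; ring.
Qed.

(** Dividing by this factor [X] yields a polynomial with constant coefficient 1, to which the
    inequalities at 0 apply. *)
Lemma cross_sum_edge_term_mulX (k j : nat) :
  exists p : {poly int}, cross_sum (edge_term 6) k j = 'X * p.
Proof.
elim: k j => [|k IHk] j /=.
  exists ('X^j * (1 - 'X) ^+ (6 - j.+1) + 'X^(j.+1) * (1 - 'X) ^+ (6 - j.+2)).
  by rewrite /edge_term /hterm mulrDr !mulrA -!exprS.
have [p ->] := IHk j; have [q ->] := IHk j.+1.
by exists (p + q *+ 2); rewrite mulrDr mulrnAr.
Qed.

Lemma hankel_addMXn (R : comNzRingType) (p q : {poly R}) (x y : R) :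
  hankel (p + 'X^5 * q) x y = hankel p x y.
Proof.
by rewrite /hankel /psum2 /psum3 /psum4 !coefD !coefXnM /= !addr0.
Qed.

(** At [(1, -1)] and with constant coefficient 1, the form is the sum of the [(x_i - x_i^2)^2]: a
    factor [1 + X] adds 0 and, in the next lemma, a factor [1 - X] adds 4. *)
Lemma hankel_mulDX (R : comNzRingType) (p : {poly R}) :
  hankel (p * (1 + 'X)) 1 (-1) = hankel p 1 (-1) + (p`_0 - p`_0 ^+ 2) ^+ 2.
Proof.
have -> : 1 + 'X = 'X - (-1)%:P :> {poly R} by rewrite polyCN opprK addrC.
by rewrite hankel_mulXsubC; rewrite /hankel /psum2 /psum3 /psum4; ring.
Qed.

Lemma hankel_mulBX (R : comNzRingType) (p : {poly R}) :
  hankel (p * (1 - 'X)) 1 (-1) = hankel p 1 (-1) + (p`_0 + p`_0 ^+ 2) ^+ 2.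
Proof.
have -> : p * (1 - 'X) = - 1 *: (p * ('X - 1%:P)).
  by rewrite scaleN1r -mulrN opprB.
rewrite hankelZ hankel_mulXsubC; rewrite /hankel /psum2 /psum3 /psum4; ring.
Qed.

(** With the sum equal to [X p], the polynomial [(1 - X)^k p] agrees with [(1 - X)^4 (1 + X)^k]
    modulo [X^5]. Counting factors [1 - X] gives [hankel p 1 (-1) = 16 - 4 k], negative for
    [k >= 5]. *)
Lemma nonreal_root_cross_sum_ge5 (k : nat) :
  (5 <= k)%N -> has_nonreal_root (cross_sum (edge_term 6) k 0).
Proof.
move=> k_ge5; have [p Ep] := cross_sum_edge_term_mulX k 0.
suff [z [z_root z_nreal]] : has_nonreal_root p.
  exists z; split=> //.
  by rewrite Ep rmorphM /= rootM z_root orbT.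
have [q] := cross_sum_edge_term_modXn k 0.
rewrite Ep expr1 mulrCA -[X in _ = X + _]mulrA [X in _ + X * _]exprS.
rewrite -[X in _ = _ + X]mulrA -mulrDr.
(* Cancelling [X] leaves a remainder divisible by [X^5], which the form does not see. *)
move=> /(mulfI (negbT (polyX_eq0 _))); rewrite mulrC => E.
have coef0BX n : ((1 - 'X : {poly int}) ^+ n)`_0 = 1.
  by rewrite -horner_coef0 !hornerE ?subr0 expr1n.
have p0 : p`_0 = 1.
  move/(congr1 (fun r : {poly int} => r`_0)): E.
  rewrite -!horner_coef0 !hornerE /= !(subr0, expr1n, addr0, mulr1, mul0r).
  by rewrite ?(expr0n, mul0r, addr0).
have hankelp n : hankel (p * (1 - 'X) ^+ n) 1 (-1) = hankel p 1 (-1) + (4 * n)%:R.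
  elim: n => [|n IHn]; first by rewrite expr0 mulr1 muln0 addr0.
  rewrite exprSr mulrA hankel_mulBX IHn coef0M p0 coef0BX.
  by rewrite mulnS [in RHS]natrD; ring.
have hankel1 n : hankel ((1 - 'X : {poly int}) ^+ n) 1 (-1) = (4 * n)%:R.
  elim: n => [|n IHn].
    by rewrite /hankel /psum2 /psum3 /psum4 expr0 !coef1 /=; ring.
  rewrite exprSr hankel_mulBX IHn coef0BX.
  by rewrite mulnS [in RHS]natrD; ring.
have hankel2 n : hankel ((1 - 'X : {poly int}) ^+ 4 * (1 + 'X) ^+ n) 1 (-1) = 16.
  elim: n => [|n IHn]; first by rewrite expr0 mulr1 hankel1.
  rewrite [(1 + 'X) ^+ _]exprSr mulrA hankel_mulDX IHn coef0M coef0BX.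
  have -> : ((1 + 'X : {poly int}) ^+ n)`_0 = 1.
    by rewrite -horner_coef0 !hornerE ?addr0 expr1n.
  by ring.
move/(congr1 (fun r => hankel r 1 (-1))): E.
rewrite hankelp hankel_addMXn hankel2 => E.
apply: contrapT => /(hankel_ge0 1 (-1)).
have : (4 * k)%:R = (4 * k)%:Z by rewrite -natz.
move: E k_ge5; move: (hankel p _ _) => a; set b := (4 * k)%:R; lia.
Qed.

Lemma nonreal_root_cross_sum (k : nat) (h : {poly int}) :
  (2 <= k)%N -> h.[-1] < 0 ->
  exists M : nat, forall m : nat, (M <= m)%N ->
    has_nonreal_root (h + cross_sum (edge_term 6) k 0 *+ m).
Proof.
move=> k_ge2 h_lt0; case: (leqP k 4) => [k_le4|k_gt4]; last first.
  apply: nonreal_root_dominant; last exact: nonreal_root_cross_sum_ge5.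
  have [q Eq] := cross_sum_edge_term_modXn k 0.
  (* The coefficient of [X] on the right is 1, so the sum cannot vanish. *)
  apply: contraPneq Eq => -> /(congr1 (fun r : {poly int} => r`_1)).
  rewrite mulr0 coef0 coefD -mulrA coefXM coefXnM /= addr0.
  by rewrite -horner_coef0 !hornerE /= ?(subr0, addr0, expr1n).
(* Substituting [X - 1] turns [X (1 - X)^(4-k) (1 + X)^k] into [E X^k]. Since [E(0) = -2^(4-k)], it
   has the sign of [h(-1)]. *)
pose E : {poly int} := ('X - 1) * (2 - 'X) ^+ (4 - k).
have k24 : (2 <= k <= 4)%N by apply/andP.
have [] := @nonreal_root_perturb k (h \Po ('X + (-1)%:P)) E k24.
  have -> : (h \Po ('X + (-1)%:P))`_0 = h.[-1].
    by rewrite -horner_coef0 horner_comp !hornerE.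
  have -> : E`_0 = - 2 ^+ (4 - k).
    by rewrite -horner_coef0 /E !hornerE /= ?(subr0, sub0r, mulN1r).
  by rewrite mulrN oppr_gt0 nmulr_rlt0 ?exprn_gt0.
move=> M nonreal; exists M => m /nonreal nonreal_m.
apply: (@has_nonreal_root_comp _ (-1)); congr has_nonreal_root: nonreal_m.
rewrite cross_sum_edge_term // expr1 comp_polyD; congr (_ + _).
rewrite -[_ *+ m]mulr_natr -[X in _ = X \Po _]mulr_natr !rmorphM !rmorphXn /=.
rewrite rmorphB rmorphD /= !comp_polyX !rmorph1 rmorph_nat /E polyCN.
congr (_ * _); rewrite [X in _ = _ * X ^+ k](_ : _ = 'X); last by ring.
congr (_ * _); congr (_ * _); congr (_ ^+ _); ring.
Qed.

(** * Borsuk-Ulam on a square *)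

(** The signed move around a 4-cycle of labels. On antipodal labels, [d = 2], the value 0 is a mere
    default. *)
Definition step (d : 'Z_4) : int := if d == 1 then 1 else if d == -1 then -1 else 0.

Lemma stepN d : step (- d) = - step d.
Proof. by case: d => [[|[|[|[|d]]]] d_lt]. Qed.

Lemma stepD d d' : d != 2 -> d' != 2 -> d + d' != 2 -> step (d + d') = step d + step d'.
Proof. by case: d d' => [[|[|[|[|d]]]] ?] [[|[|[|[|d']]]] ?]. Qed.

Lemma step_triangle x y z : y - x != 2 -> z - y != 2 -> z - x != 2 ->
  step (y - x) + step (z - y) = step (z - x).
Proof.
have -> : z - x = (y - x) + (z - y) by rewrite [RHS]addrC addrA subrK.
by move=> *; rewrite -stepD.
Qed.

Lemma step_intr d : d != 2 -> (step d)%:~R = d.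
Proof. by case: d => [[|[|[|[|d]]]] ?] // _; apply/val_inj. Qed.

Section Tucker.
Variables (N : nat) (l : nat -> nat -> 'Z_4).
Hypothesis cell : forall i j, (i < N)%N -> (j < N)%N -> forall a b a' b' : bool,
  l (i + a) (j + b) - l (i + a') (j + b') != 2.

Let hstep i j := step (l i.+1 j - l i j).
Let vstep i j := step (l i j.+1 - l i j).
(* An integer lift of the labels, normalised to vanish at the origin. *)
Let height i j : int := \sum_(j' < j) vstep 0 j' + \sum_(i' < i) hstep i' j.

Lemma height_hstep i j : height i.+1 j = height i j + hstep i j.
Proof. by rewrite /height big_ord_recr addrA. Qed.

(** Path independence: [height] follows the column 0 and then a row, so vertical increments
    elsewhere require that nothing winds around a cell. Both ways around a cell equal the step along
    its diagonal. *)
Lemma height_vstep i j : (i <= N)%N -> (j < N)%N -> height i j.+1 = height i j + vstep i j.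
Proof.
move=> i_N j_N; elim: i i_N => [_|i IHi i_N].
  by rewrite /height !big_ord0 !addr0 big_ord_recr.
rewrite !height_hstep {}IHi ?(ltnW i_N) // -!addrA; congr (_ + _).
have c := cell i_N j_N.
have := c true true false false; have := c true true true false.
have := c true true false true; have := c true false false false.
have := c false true false false; rewrite /= !addn1 !addn0 /hstep /vstep.
move=> c1 c2 c3 c4 c5.
by rewrite !step_triangle.
Qed.

Lemma height_mod i j : (0 < N)%N -> (i <= N)%N -> (j <= N)%N -> (height i j)%:~R = l i j - l 0 0.
Proof.
move=> N_gt0 i_N; elim: j => [_|j IHj j_N]; last first.
  rewrite height_vstep // rmorphD /= IHj ?(ltnW j_N) // step_intr.
    by rewrite addrC addrA subrK.
  have [i_lt|N_i] := ltnP i N.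
    by have := cell i_lt j_N false true false false; rewrite /= !addn0 addn1.
  (* The last column has no cell to its right, so the cell to its left is used. *)
  have -> : i = (N.-1).+1 by lia.
  have N_lt : (N.-1 < N)%N by lia.
  by have := cell N_lt j_N true true true false; rewrite /= !addn0 !addn1.
elim: i i_N => [_|i IHi i_N]; first by rewrite /height !big_ord0 addr0 subrr.
rewrite height_hstep rmorphD /= IHi ?(ltnW i_N) // step_intr.
  by rewrite addrC addrA subrK.
by have := cell i_N N_gt0 true false false false; rewrite /= !addn0 addn1.
Qed.

(** Opposite boundary edges have opposite steps, so the height difference of opposite boundary
    points is constant along the boundary. Half a turn exchanges the two points, hence the constant
    is 0; but modulo 4 it is 2. *)
Lemma tucker_square : (0 < N)%N ->
  (forall i, (i <= N)%N -> l (N - i) N = l i 0 + 2) ->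
  (forall j, (j <= N)%N -> l 0 (N - j) = l N j + 2) -> False.
Proof.
move=> N_gt0 bottom right.
have height_bottom i : (i <= N)%N -> height (N - i) N - height i 0 = height N N - height 0 0.
  elim: i => [|i IHi] i_N; first by rewrite subn0.
  rewrite -(IHi (ltnW i_N)) (_ : N - i = (N - i.+1).+1)%N; last by lia.
  rewrite !height_hstep; suff -> : hstep (N - i.+1) N = - hstep i 0 by ring.
  rewrite /hstep -stepN bottom // (_ : (N - i.+1).+1 = N - i)%N; last by lia.
  by rewrite bottom ?(ltnW i_N) //; congr step; ring.
have height_right j : (j <= N)%N -> height 0 (N - j) - height N j = height 0 N - height N 0.
  elim: j => [|j IHj] j_N; first by rewrite subn0.
  rewrite -(IHj (ltnW j_N)) (_ : N - j = (N - j.+1).+1)%N; last by lia.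
  rewrite !height_vstep //; last by lia.
  suff -> : vstep 0 (N - j.+1) = - vstep N j by ring.
  rewrite /vstep -stepN right // (_ : (N - j.+1).+1 = N - j)%N; last by lia.
  by rewrite right ?(ltnW j_N) //; congr step; ring.
have := height_bottom N (leqnn N); have := height_right N (leqnn N); rewrite !subnn => eq1 eq2.
have height0 : height N N - height 0 0 = 0 by lia.
have := height_mod N_gt0 (leqnn N) (leqnn N).
have -> : height N N = height 0 0 by lia.
have -> : height 0 0 = 0 by rewrite /height !big_ord0 addr0.
have -> : l N N = l 0 0 + 2 by rewrite -bottom // subn0.
by rewrite addrAC subrr add0r.
Qed.

End Tucker.

Local Open Scope classical_set_scope.

Section QuadrantLabel.
Variable R : realType.

(** The plane is cut along its two diagonals, and the sectors are numbered cyclically so that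
    opposite ones differ by 2. *)
Definition quadrant (x y : R) : 'Z_4 :=
  if `|y| <= `|x| then if 0 < x then 0 else 2 else if 0 < y then 1 else - 1.

Lemma quadrantN (x y : R) : (x != 0) || (y != 0) -> quadrant (- x) (- y) = quadrant x y + 2.
Proof.
rewrite /quadrant !normrN !oppr_gt0; have [le_yx|lt_xy] := leP `|y| `|x|.
  have [x_lt0|x_gt0|x0] := ltgtP x 0; [by move=> _; apply/val_inj..|].
  by move: le_yx; rewrite x0 normr0 normr_le0 => ->.
have [y_lt0|y_gt0|y0] := ltgtP y 0; [by move=> _; apply/val_inj..|].
by move: lt_xy; rewrite y0 normr0 ltNge normr_ge0.
Qed.

(** In opposite sectors the product of the dominant coordinates is nonpositive and outweighs the
    other product. *)
Lemma quadrant_adjacent (x y x' y' : R) :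
  0 < x * x' + y * y' -> quadrant x' y' - quadrant x y != 2.
Proof.
rewrite /quadrant => inner_gt0.
have le_absM (a b c d : R) : `|a| <= `|b| -> `|c| <= `|d| -> a * c <= `|b * d|.
  by move=> ab cd; apply: le_trans (ler_norm _) _; rewrite !normrM ler_pM.
have [y'x'|/ltW x'y'] := leP `|y'| `|x'|; have [yx|/ltW xy] := leP `|y| `|x|.
- have := le_absM y x y' x' yx y'x'.
  do 2![case: ltP => ?] => //; have le0 : x * x' <= 0 by [nra];
    by rewrite ler0_norm // => ?; exfalso; lra.
- by do 2![case: ltP => _].
- by do 2![case: ltP => _].
- have := le_absM x y x' y' xy x'y'.
  do 2![case: ltP => ?] => //; have le0 : y * y' <= 0 by [nra];
    by rewrite ler0_norm // => ?; exfalso; lra.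
Qed.

End QuadrantLabel.

(** Without a zero, the values of [(G1, G2)] at the corners of a cell of a fine grid have positive
    inner products. Their sectors then label the grid in a way that [tucker_square] forbids. *)
Lemma borsuk_ulam_square (R : realType) (G1 G2 : R * R -> R) :
  continuous G1 -> continuous G2 ->
  (forall p, `|p.1| = 1 \/ `|p.2| = 1 -> G1 (- p) = - G1 p /\ G2 (- p) = - G2 p) ->
  exists p, [/\ `|p.1| <= 1, `|p.2| <= 1, G1 p = 0 & G2 p = 0].
Proof.
move=> G1_cont G2_cont odd; apply: contrapT => no_zero.
pose Q : set (R * R) := `[-1, 1]%classic `*` `[-1, 1]%classic.
have QP p : Q p <-> `|p.1| <= 1 /\ `|p.2| <= 1.
  by rewrite /Q /= !in_itv /= !ler_norml; split=> -[? ?]; split.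
have Q_neq0 p : Q p -> (G1 p != 0) || (G2 p != 0).
  move=> /QP[p1 p2]; apply: contrapT => /negP; rewrite negb_or !negbK => /andP[/eqP ? /eqP ?].
  by apply: no_zero; exists p.
pose inner (p q : R * R) := G1 p * G1 q + G2 p * G2 q.
have inner_cont : continuous (fun pq : (R * R) * (R * R) => inner pq.1 pq.2).
  move=> pq; apply: cvgD; apply: cvgM.
  - apply: continuous_comp; [exact: cvg_fst|exact: G1_cont].
  - apply: continuous_comp; [exact: cvg_snd|exact: G1_cont].
  - apply: continuous_comp; [exact: cvg_fst|exact: G2_cont].
  - apply: continuous_comp; [exact: cvg_snd|exact: G2_cont].
have Q_compact : compact Q by apply: compact_setX; apply: segment_compact.
(* Compactness makes the scale uniform in [p]. The grid below has mesh [2 / N.+1], and the constant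
   3 makes the bound strict. *)
have [N _ /(_ N (leqnn N)) N_good] : \forall N \near \oo, forall p, Q p -> forall q,
    `|p.1 - q.1| < 3 / N.+1%:R -> `|p.2 - q.2| < 3 / N.+1%:R -> 0 < inner p q.
  apply: (compact_near_coveringP _).1 => // p Qp.
  have inner_gt0 : 0 < inner p p.
    by rewrite /inner -!expr2; case/orP: (Q_neq0 p Qp) => ?; [apply: ltr_pwDl|apply: ltr_wpDl];
      rewrite ?sqr_ge0 ?exprn_even_gt0.
  have : nbhs (p, p) [set pq | 0 < inner pq.1 pq.2].
    apply: (inner_cont (p, p) [set r | 0 < r]); exact: lt_nbhsr.
  move=> /nbhs_ballP[e /= e_gt0 ball_inner].
  have e2_gt0 : 0 < e / 2 by rewrite divr_gt0.
  have e6_gt0 : 0 < e / 2 / 3 by rewrite divr_gt0.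
  near=> p' i => q pq1 pq2.
  have [p1 p2] : ball p (e / 2) p' by near: p'; apply: nbhsx_ballx.
  have i_large : 3 / i.+1%:R < e / 2.
    rewrite mulrC -ltr_pdivlMr //; near: i; exact: (near_infty_natSinv_lt (PosNum e6_gt0)).
  move: p1 p2; rewrite -!ball_normE /= => p1 p2.
  have tri (a b c : R) : `|a - b| < e / 2 -> `|b - c| < 3 / i.+1%:R -> `|a - c| < e.
    move=> ab /lt_trans/(_ i_large) bc; rewrite -(subrKA b).
    apply: le_lt_trans (ler_normD _ _) _; rewrite [ltRHS](splitr e); exact: ltrD.
  apply: (ball_inner (p', q)); split; split; rewrite /= -?ball_normE /=.
  - by lra.
  - by lra.
  - exact: tri p1 pq1.
  - exact: tri p2 pq2.
pose n := N.+1; pose x i : R := -1 + 2 * i%:R / n%:R.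
have n_gt0 : 0 < n%:R :> R by rewrite ltr0n.
have x_in i : (i <= n)%N -> `|x i| <= 1.
  rewrite -(ler_nat R) => i_n; have : 0 <= i%:R / n%:R :> R /\ i%:R / n%:R <= 1 :> R.
    by rewrite divr_ge0 ?ler0n //= ler_pdivrMr // mul1r.
  by rewrite /x ler_norml -mulrA => -[? ?]; lra.
have xN i : (i <= n)%N -> x (n - i)%N = - x i.
  by move=> i_n; rewrite /x natrB //; field; rewrite gt_eqF.
have x0 : x 0 = -1 by rewrite /x mulr0 mul0r addr0.
have xn : x n = 1 by rewrite /x mulfK ?gt_eqF //; lra.
have x_step i (a a' : bool) : `|x (i + a)%N - x (i + a')%N| < 3 / n%:R.
  have -> : x (i + a)%N - x (i + a')%N = 2 * (a%:R - a'%:R) / n%:R.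
    by rewrite /x !natrD; field; rewrite gt_eqF.
  rewrite normrM normfV (gtr0_norm n_gt0) ltr_pM2r ?invr_gt0 // normrM.
  case: a a' => [] []; rewrite ?subrr ?normr0 ?subr0 ?sub0r ?normrN ?normr1; rewrite ?normr_nat; lra.
pose l i j := quadrant (G1 (x i, x j)) (G2 (x i, x j)).
have inQ i j : (i <= n)%N -> (j <= n)%N -> Q (x i, x j).
  by move=> i_n j_n; apply/QP; rewrite !x_in.
apply: (@tucker_square n l) => //.
- move=> i j i_n j_n a b a' b'; apply: quadrant_adjacent.
  apply: N_good; [|exact: x_step|exact: x_step].
  by apply: inQ; rewrite -addn1 in i_n j_n; [case: a'|case: b']; lia.
- move=> i i_n; rewrite /l; have -> : x n = - x 0 by rewrite xn x0 opprK.
  rewrite xN //; have [] := odd (x i, x 0); first by right; rewrite x0 normrN1.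
  rewrite -[- (x i, x 0)]/(- x i, - x 0) => -> ->.
  by apply: quadrantN; apply/Q_neq0/inQ.
- move=> j j_n; rewrite /l; have -> : x 0 = - x n by rewrite xn x0.
  rewrite xN //; have [] := odd (x n, x j); first by left; rewrite xn normr1.
  rewrite -[- (x n, x j)]/(- x n, - x j) => -> ->.
  by apply: quadrantN; apply/Q_neq0/inQ.
Unshelve. all: by end_near. Qed.

Lemma continuous_pair (T U V : topologicalType) (f : T -> U) (g : T -> V) (x : T) :
  {for x, continuous f} -> {for x, continuous g} ->
  {for x, continuous (fun y => (f y, g y))}.
Proof. by move=> f_cont g_cont; apply: cvg_pair. Qed.

(** By [borsuk_ulam_square], [(K1, K2)] agrees at some [H p] and [- H p]. Injectivity forces
    [H p = 0]; yet its first two coordinates vanish only at [p = 0], where the third is [r]. *)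
Lemma no_local_embedding (R : realType) (K1 K2 : R * R * R -> R) (U : set (R * R * R)) :
  continuous K1 -> continuous K2 -> nbhs (0 : R * R * R) U ->
  ~ (forall p q, U p -> U q -> K1 p = K1 q -> K2 p = K2 q -> p = q).
Proof.
move=> K1_cont K2_cont /nbhs_ballP[e /= e_gt0 ball_U] K_inj.
pose r := e / 2; have r_gt0 : 0 < r by rewrite divr_gt0.
(* [H] and [- H] together parametrise a 2-sphere around 0, glued along the boundary
   of the square, where [H] is odd. *)
pose H (p : R * R) : R * R * R :=
  ((r * p.1, r * p.2), r * ((1 - p.1 ^+ 2) * (1 - p.2 ^+ 2))).
have H_cont : continuous H.
  move=> p; have fst_cont : {for p, continuous (fst : R * R -> R)} by exact: cvg_fst.
  have snd_cont : {for p, continuous (snd : R * R -> R)} by exact: cvg_snd.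
  apply: (@continuous_pair _ _ _ (fun p => (r * p.1, r * p.2))
    (fun p => r * ((1 - p.1 ^+ 2) * (1 - p.2 ^+ 2)))).
    apply: (@continuous_pair _ _ _ (fun p => r * p.1) (fun p => r * p.2)).
    - by apply: cvgM => //; apply: cvg_cst.
    - by apply: cvgM => //; apply: cvg_cst.
  apply: cvgM; first exact: cvg_cst.
  by apply: cvgM; apply: cvgB; [exact: cvg_cst|apply: cvgM|exact: cvg_cst|apply: cvgM].
have HN_cont : continuous (fun p => - H p) by move=> p; apply: cvgN; apply: H_cont.
pose G (K : R * R * R -> R) p := K (H p) - K (- H p).
have G_cont K : continuous K -> continuous (G K).
  move=> K_cont p; apply: cvgB.
    by apply: continuous_comp; [exact: H_cont|exact: K_cont].
  by apply: continuous_comp; [exact: HN_cont|exact: K_cont].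
have HN p : `|p.1| = 1 \/ `|p.2| = 1 -> H (- p) = - H p.
  move=> p_bd; have bd0 : (1 - p.1 ^+ 2) * (1 - p.2 ^+ 2) = 0.
    by case: p_bd => p_bd; rewrite -[p.1 ^+ 2]real_normK ?num_real // -[p.2 ^+ 2]real_normK
      ?num_real // p_bd; ring.
  rewrite /H /= !sqrrN bd0 mulr0 -[RHS]/(- (r * p.1), - (r * p.2), - 0).
  by rewrite !mulrN oppr0.
have [p|p [p1 p2 G1 G2]] := borsuk_ulam_square (G_cont K1 K1_cont) (G_cont K2 K2_cont).
  by move=> /HN HNp; rewrite /G HNp opprK !opprB.
have U_H (x : R) : `|x| <= 1 -> `|0 - r * x| < e.
  move=> x1; rewrite sub0r normrN normrM (gtr0_norm r_gt0).
  by apply: (le_lt_trans (y := r)); [rewrite ler_piMr // ltW|rewrite /r; lra].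
have U_Hm (x : R) : `|x| <= 1 -> `|0 - - (r * x)| < e.
  by move=> x1; rewrite -mulrN U_H ?normrN.
have p3 : `|(1 - p.1 ^+ 2) * (1 - p.2 ^+ 2)| <= 1.
  have sqr01 (x : R) : `|x| <= 1 -> 0 <= 1 - x ^+ 2 <= 1.
    move=> x1; rewrite -[x ^+ 2]real_normK ?num_real // lerBlDr lerDl sqr_ge0 andbT.
    by rewrite subr_ge0 expr_le1.
  have /andP[? ?] := sqr01 _ p1; have /andP[? ?] := sqr01 _ p2.
  by rewrite ger0_norm ?mulr_ge0 // mulr_ile1.
have UH : U (H p) by apply: ball_U; split; [split|]; rewrite -ball_normE /= U_H.
have UHm : U (- H p) by apply: ball_U; split; [split|]; rewrite -ball_normE /= U_Hm.
have := K_inj _ _ UH UHm (subr0_eq G1) (subr0_eq G2).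
rewrite -[- H p]/(- (r * p.1), - (r * p.2), - (r * ((1 - p.1 ^+ 2) * (1 - p.2 ^+ 2)))) => -[e1 e2 e3].
have p10 : p.1 = 0 by nra.
have p20 : p.2 = 0 by nra.
by move: e3; rewrite p10 p20; nra.
Qed.

(** * Three-dimensional slices of the 5-sphere *)

Lemma continuous_matrix (R : realType) (T : topologicalType) (m n : nat) (f : T -> 'M[R]_(m, n)) :
  (forall i j, continuous (fun x => f x i j)) -> continuous f.
Proof.
move=> f_cont x A [P P_nbhs P_A].
have : \forall y \near x, forall ij : 'I_m * 'I_n, P ij.1 ij.2 (f y ij.1 ij.2).
  by apply: filter_forall => -[i j]; apply: (f_cont i j x); apply: P_nbhs.
by apply: filterS => y Py; apply: P_A => i j; apply: (Py (i, j)).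
Qed.

(** Move [q] along three coordinates other than one with [q 0 j0 != 0], then normalise. The fixed
    coordinate [j0] keeps the vector nonzero and recovers the norm, whence injectivity. Indices are
    added modulo 6. *)
Lemma sphere_chart (R : realType) (q : 'rV[R]_6) :
  \sum_i q 0 i ^+ 2 = 1 ->
  exists c : R * R * R -> 'rV[R]_6,
    [/\ continuous c, forall p, \sum_i c p 0 i ^+ 2 = 1, c 0 = q & injective c].
Proof.
move=> q1.
have [j0 qj0] : exists j0, q 0 j0 != 0.
  apply: contrapT => /forallNP q0; have : \sum_i q 0 i ^+ 2 = 0.
    by rewrite big1 // => i _; have /negP := q0 i; rewrite negbK => /eqP ->; rewrite expr0n.
  by rewrite q1; apply/eqP; rewrite oner_eq0.
pose v (p : R * R * R) i : R := q 0 i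
  + p.1.1 * (i == j0 + 1)%:R + p.1.2 * (i == j0 + 2)%:R + p.2 * (i == j0 + 3)%:R.
pose s p : R := \sum_i v p i ^+ 2.
have vE p (a : 'I_6) : v p (j0 + a)
    = q 0 (j0 + a) + p.1.1 * (a == 1)%:R + p.1.2 * (a == 2)%:R + p.2 * (a == 3)%:R.
  by rewrite /v !(inj_eq (addrI j0)).
have v0 p : v p j0 = q 0 j0 by have := vE p 0; rewrite addr0 => ->; rewrite !mulr0 !addr0.
have s_gt0 p : 0 < s p.
  rewrite /s (bigD1 j0) //= v0 ltr_pwDl ?exprn_even_gt0 //.
  by apply: sumr_ge0 => i _; apply: sqr_ge0.
have v_cont i : continuous (v^~ i).
  move=> p.
  have c1 : {for p, continuous (fun p : R * R * R => p.1.1)}.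
    by apply: (@cvg_comp _ _ _ (fst : R * R * R -> R * R) fst); [exact: cvg_fst|exact: cvg_fst].
  have c2 : {for p, continuous (fun p : R * R * R => p.1.2)}.
    by apply: (@cvg_comp _ _ _ (fst : R * R * R -> R * R) snd); [exact: cvg_fst|exact: cvg_snd].
  have c3 : {for p, continuous (fun p : R * R * R => p.2)} by exact: cvg_snd.
  have cM (f : R * R * R -> R) (a : R) :
      {for p, continuous f} -> {for p, continuous (fun p => f p * a)}.
    by move=> f_cont; apply: cvgM => //; exact: cvg_cst.
  by apply: cvgD (cM _ _ c3); apply: cvgD (cM _ _ c2); apply: cvgD (cM _ _ c1); exact: cvg_cst.
have s_cont : continuous s.
  move=> p; apply: (@cvg_big _ _ +%R) => [|i _]; first exact: add_continuous.
  by apply: cvgM; apply: v_cont.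
pose c p := \row_i (v p i / Num.sqrt (s p)).
exists c; split.
- apply: continuous_matrix => i j.
  have -> : (fun p => c p i j) = (fun p => v p j / Num.sqrt (s p)).
    by apply/funext => p; rewrite /c mxE.
  move=> p; apply: cvgM; first exact: v_cont.
  apply: cvgV; first by rewrite gt_eqF // sqrtr_gt0.
  by apply: continuous_comp; [exact: s_cont|exact: sqrt_continuous].
- move=> p; under eq_bigr do rewrite mxE expr_div_n sqr_sqrtr ?(ltW (s_gt0 p)) //.
  by rewrite -mulr_suml -/(s p) mulfV // gt_eqF.
- have v00 i : v 0 i = q 0 i by rewrite /v /= !mul0r !addr0.
  have s0 : s 0 = 1 by rewrite -q1; apply: eq_bigr => i _; rewrite v00.
  by apply/rowP => i; rewrite mxE v00 s0 sqrtr1 divr1.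
- move=> p p' /rowP cpp'.
  have vs i : v p i / Num.sqrt (s p) = v p' i / Num.sqrt (s p').
    by have := cpp' i; rewrite !mxE.
  have ss : (Num.sqrt (s p))^-1 = (Num.sqrt (s p'))^-1.
    by have := vs j0; rewrite !v0; apply: mulfI.
  have vv i : v p i = v p' i.
    by have := vs i; rewrite ss; apply: mulIf; rewrite invr_neq0 // gt_eqF // sqrtr_gt0.
  have := vv (j0 + 3); have := vv (j0 + 2); have := vv (j0 + 1).
  rewrite !vE /= !(mulr0, mulr1, addr0) => /addrI e1 /addrI e2 /addrI e3.
  by move: e1 e2 e3; case: p p' {cpp' vs ss vv} => [[? ?] ?] [[? ?] ?] /= -> -> ->.
Qed.

Local Close Scope classical_set_scope.
Local Close Scope ring_scope.

(** * Edge subdivisions *)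

Local Open Scope fset_scope.

Lemma in_link (X : complex) (s t : {fset nat}) :
  (t \in link X s) = [&& t \in X, s `|` t \in X & s `&` t == fset0].
Proof. by rewrite /link !inE. Qed.

Section EdgeSubdivision.
Variables (X : complex) (u v e : nat).
Let eta := [fset u; v].
Hypotheses (X_closed : forall s t, s \in X -> t `<=` s -> t \in X)
           (u_neq_v : u != v) (eX : fresh X e).

Lemma freshP s : s \in X -> e \notin s.
Proof. by move=> sX; have /allP := eX; apply. Qed.

Lemma link_edgeP t :
  reflect [/\ t `|` eta \in X, u \notin t & v \notin t] (t \in link X eta).
Proof.
rewrite in_link.
apply: (iffP and3P) => [[tX etX /eqP et0]|[tX ut vt]].
  have notin x : x \in eta -> x \notin t.
    by move=> x_eta; apply/negP => xt; have := in_fset0 x; rewrite -et0 inE x_eta xt.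
  by rewrite fsetUC etX !notin // !inE eqxx ?orbT.
split; first by apply: X_closed tX _; apply: fsubsetUl.
  by rewrite fsetUC.
apply/eqP/fsetP => x; rewrite !inE.
by case: eqP => [->|_] /=; [rewrite (negPf ut)|case: eqP => [->|//]; rewrite (negPf vt)].
Qed.

Lemma fsubset_edge s : (eta `<=` s) = (u \in s) && (v \in s).
Proof. by rewrite /eta fsubUset !fsub1set. Qed.

(** Merges the three kinds of faces: a face containing [e] is tested by replacing [e] with the whole
    edge. *)
Lemma in_edge_sub s :
  (s \in edge_sub X eta e) =
  (if e \in s then (s `\ e) `|` eta \in X else s \in X) && ~~ (eta `<=` s).
Proof.
have star_fresh t : t \in link X eta -> [/\ e \notin t, u != e & v != e].
  move=> /link_edgeP[/freshP + _ _]; rewrite !inE !negb_or => /and3P[-> ? ?].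
  by split=> //; rewrite eq_sym.
rewrite /edge_sub !inE; apply/idP/idP => [/orP[/orP[]|]|].
- by move=> /andP[sX ->]; rewrite (negPf (freshP sX)) sX.
- move=> /imfsetP[t /= t_lk ->]; rewrite !inE eqxx orbT.
  have [et ue ve] := star_fresh t t_lk; have /link_edgeP[tX ut vt] := t_lk.
  rewrite fsubset_edge !inE (negPf ut) (negPf ue) andbT /=.
  suff -> : (t `|` [fset e]) `\ e = t by [].
  by apply/fsetP => x; rewrite !inE; have [->|_] := eqVneq x e; rewrite ?(negPf et) ?orbF.
- move=> /imfset2P[t /= t_lk [w /= w_eta ->]]; rewrite !inE eqxx !orbT.
  have [et ue ve] := star_fresh t t_lk; have /link_edgeP[tX ut vt] := t_lk.
  apply/andP; split.
    suff -> : ((t `|` [fset w; e]) `\ e) `|` eta = t `|` eta by [].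
    apply/fsetP => x; move: w_eta; rewrite !inE.
    have [->|_] := eqVneq x e; first by rewrite (negPf et).
    have [->|_] := eqVneq x w; last by rewrite /= ?orbF.
    by move=> /= ->; rewrite !orbT.
  rewrite fsubset_edge !inE (negPf ut) (negPf vt) (negPf ue) (negPf ve) !orbF /=.
  by apply/negP => /andP[/eqP uw /eqP vw]; move: u_neq_v; rewrite uw vw eqxx.
case: ifP => [es|_ -> //]; rewrite fsubset_edge => /andP[star uvs].
(* The link face underlying [s]; which endpoint lies in [s], if any, decides the kind of new
   face. *)
pose t := s `\ e `\ u `\ v.
have t_lk : t \in link X eta.
  apply/link_edgeP; split; last 2 first.
  - by rewrite !inE eqxx andbF.
  - by rewrite !inE eqxx.
  suff -> : t `|` eta = (s `\ e) `|` eta by [].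
  by apply/fsetP => x; rewrite !inE; case: (x == u); case: (x == v); rewrite /= ?orbT ?orbF.
have [et ue ve] := star_fresh t t_lk.
have [us|us] := boolP (u \in s).
  have vs : v \notin s by move: uvs; rewrite us.
  apply/orP; right; apply/imfset2P; exists t => //; exists u; first by rewrite /= !inE eqxx.
  apply/fsetP => x; rewrite !inE.
  have [->|] := eqVneq x u; first by rewrite us ?orbT.
  have [->|] := eqVneq x e; first by rewrite es !orbT.
  by have [->|] := eqVneq x v; rewrite //= ?(negPf vs) ?orbF.
have [vs|vs] := boolP (v \in s).
  apply/orP; right; apply/imfset2P;  exists t => //; exists v; first by rewrite /= !inE eqxx orbT.
  apply/fsetP => x; rewrite !inE.
  have [->|] := eqVneq x v; first by rewrite vs ?orbT.
  have [->|] := eqVneq x e; first by rewrite es !orbT.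
  by have [->|] := eqVneq x u; rewrite //= ?(negPf us) ?orbF.
apply/orP; left; apply/orP; right; apply/imfsetP; exists t => //.
apply/fsetP => x; rewrite !inE.
have [->|] := eqVneq x e; first by rewrite es !orbT.
have [->|] := eqVneq x v; first by rewrite (negPf vs).
by have [->|] := eqVneq x u; rewrite //= ?(negPf us) ?orbF.
Qed.

Lemma edge_sub_closed s t :
  s \in edge_sub X eta e -> t `<=` s -> t \in edge_sub X eta e.
Proof.
rewrite !in_edge_sub => /andP[s_in not_eta_s] t_s.
have -> : ~~ (eta `<=` t) by apply: contra not_eta_s => /fsubset_trans; apply.
rewrite andbT; case: ifP => et; last first.
  case: ifP s_in => es /X_closed; apply=> //; apply: fsubset_trans (fsubsetUl _ _).
  by rewrite fsubsetD1 t_s et.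
move: s_in; rewrite (fsubsetP t_s _ et) => /X_closed; apply.
by apply: fsetSU; apply: fsetSD.
Qed.

Hypothesis etaX : eta \in X.

Lemma fresh_edge : (e != u) && (e != v).
Proof. by have := freshP etaX; rewrite !inE negb_or. Qed.

(** This is why every subdivision adds the same polynomial. Replacing [e] by the edge turns faces
    [{e, w} U t] into faces [eta U t]; disjointness keeps [w] out of [t], and the ban on containing
    [eta] keeps out the other endpoint. *)
Lemma link_edge_sub (w : nat) :
  w \in eta -> link (edge_sub X eta e) [fset e; w] = link X eta.
Proof.
have /andP[eu ev] := fresh_edge.
move=> w_eta; have we : w != e by move: w_eta; rewrite !inE => /orP[] /eqP ->; rewrite eq_sym.
apply/fsetP => t; apply/idP/idP; last first.
  move=> t_lk; have /link_edgeP[tX ut vt] := t_lk.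
  have et : e \notin t by have := freshP tX; rewrite !inE !negb_or => /andP[].
  have wt : w \notin t by move: w_eta; rewrite !inE => /orP[] /eqP ->.
  rewrite in_link; apply/and3P; split.
  - rewrite in_edge_sub (negPf et) fsubset_edge (negPf ut) andbT.
    by apply: X_closed tX _; apply: fsubsetUl.
  - rewrite in_edge_sub !inE eqxx fsubset_edge !inE (negPf ut) (negPf vt) !orbF.
    rewrite ![_ == e]eq_sym (negPf eu) (negPf ev) /=; apply/andP; split.
      suff -> : ([fset e; w] `|` t) `\ e `|` eta = t `|` eta by [].
      apply/fsetP => x; move: w_eta; rewrite !inE.
      have [->|_] := eqVneq x e; first by rewrite (negPf et).
      have [->|_] := eqVneq x w; last by rewrite /= ?orbF.
    by move=> /= ->; rewrite !orbT.
    by apply/negP => /andP[/eqP uw /eqP vw]; move: u_neq_v; rewrite uw vw eqxx.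
  - by apply/eqP/fsetP => x; rewrite !inE; case: eqP => [->|_]/=; rewrite ?(negPf et) //;
      case: eqP => [->|_] //=; rewrite (negPf wt).
rewrite in_link => /and3P[_ ewt_in /eqP ewt0].
have notin x : x \in [fset e; w] -> x \notin t.
  by move=> x_ew; apply/negP => xt; have := in_fset0 x; rewrite -ewt0 inE x_ew xt.
have et : e \notin t by rewrite notin // !inE eqxx.
have wt : w \notin t by rewrite notin // !inE eqxx orbT.
rewrite in_edge_sub !inE eqxx fsubset_edge /= in ewt_in.
have [star uv_ewt] := andP ewt_in.
rewrite !inE ![_ == e]eq_sym (negPf eu) (negPf ev) /= in uv_ewt.
suff [ut vt] : u \notin t /\ v \notin t.
  apply/link_edgeP; split=> //; apply: X_closed star _.
  by apply/fsubsetP => x; rewrite !inE; case: (eqVneq x e) => [->|_]; rewrite ?(negPf et) //=;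
    move=> /orP[->|->]; rewrite ?orbT.
by move: w_eta wt uv_ewt; rewrite !inE => /orP[] /eqP -> wt; rewrite eqxx ?orbT /= ?andbT ?wt;
  rewrite negb_or => /andP[].
Qed.
End EdgeSubdivision.

(** * Sums over faces depending on the number of vertices *)

Section FaceSums.
Variables (V : zmodType) (F : nat -> V).

Definition face_sum (X : complex) : V := (\sum_(s <- X) F #|` s|)%R.

Lemma face_sumU (A B : complex) : [disjoint A & B] ->
  face_sum (A `|` B) = (face_sum A + face_sum B)%R.
Proof.
move=> /fdisjointP AB; rewrite /face_sum (big_fsetID _ (mem A)); congr (_ + _)%R.
  by apply: eq_fbigl => s; rewrite !inE /=; case: (s \in A); rewrite ?andbF.
apply: eq_fbigl => s; rewrite !inE /=.
by have [/AB|_] := boolP (s \in A); rewrite ?andbT //= => /negPf ->.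
Qed.

Lemma face_sum_join (L : complex) (r : {fset nat}) :
  (forall s, s \in L -> [disjoint s & r]) ->
  face_sum [fset s `|` r | s in L] = (\sum_(s <- L) F (#|` s| + #|` r|)%N)%R.
Proof.
move=> Lr; rewrite /face_sum big_imfset /=; last first.
  move=> s t /Lr /fdisjointP sr /Lr /fdisjointP tr st.
  apply/fsetP => x; move/fsetP/(_ x): st; rewrite !inE.
  have [xr|_] := boolP (x \in r); last by rewrite !orbF.
  by rewrite (contraTF (sr x) xr) (contraTF (tr x) xr).
rewrite !big_seq; apply: eq_bigr => s /Lr sr.
by rewrite cardfsU (eqP sr) cardfs0 subn0.
Qed.

(** Faces not containing the edge are common to both complexes; the others are disjoint families of
    joins with link faces, one in [X] and three in the subdivision. *)
Lemma face_sum_edge_sub (X : complex) (u v e : nat) :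
  (forall s t, s \in X -> t `<=` s -> t \in X) -> u != v -> fresh X e ->
  [fset u; v] \in X ->
  face_sum (edge_sub X [fset u; v] e) =
  (face_sum X + \sum_(s <- link X [fset u; v]) (F #|` s|.+1 + F #|` s|.+2))%R.
Proof.
move=> X_closed uv eX etaX.
have /andP[eu ev] := fresh_edge eX etaX.
set eta := [fset u; v]; set L := link X eta; set Y := edge_sub X eta e.
have Lnot s : s \in L -> [/\ u \notin s, v \notin s & e \notin s].
  move=> /(link_edgeP u v X_closed)[sX us vs]; split=> //.
  by have := freshP eX sX; rewrite !inE negb_or => /andP[].
have EX : X = [fset s in X | ~~ (eta `<=` s)] `|` [fset s `|` eta | s in L].
  apply/fsetP => s; rewrite !inE; apply/idP/idP => [sX|/orP[/andP[]//|]].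
    rewrite sX /=; case: (boolP (eta `<=` s)) => //= eta_s.
    have Es : (s `\` eta) `|` eta = s.
      apply/fsetP => x; rewrite in_fsetU in_fsetD.
      by have [/(fsubsetP eta_s)|] := boolP (x \in eta); rewrite ?orbT ?orbF.
    apply/imfsetP; exists (s `\` eta); last by [].
    by apply/(link_edgeP u v X_closed); rewrite -/eta Es !in_fsetD fset21 fset22.
  by move=> /imfsetP[t /= /(link_edgeP u v X_closed)[tX _ _] ->].
have EY : Y = [fset s in X | ~~ (eta `<=` s)] `|` ([fset s `|` [fset e] | s in L]
    `|` ([fset s `|` [fset u; e] | s in L] `|` [fset s `|` [fset v; e] | s in L])).
  rewrite /Y /edge_sub -/L -fsetUA; congr (_ `|` (_ `|` _)).
  apply/fsetP => s; rewrite !inE; apply/imfset2P/orP => [[t tL [w]]|].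
    rewrite /= !inE => /orP[] /eqP -> ->; [left|right]; apply/imfsetP; exists t => //.
  case=> /imfsetP[t tL ->]; exists t => //; [exists u|exists v]; rewrite //= !inE eqxx ?orbT //.
have disj_join (r r' : {fset nat}) x : x \in r -> x \notin r' -> x \in [fset u; v; e] ->
    [disjoint [fset s `|` r | s in L] & [fset s `|` r' | s in L]].
  move=> xr xr' x_uve; apply/fdisjointP => _ /imfsetP[s _ ->].
  apply/imfsetP => -[t /Lnot [ut vt et] /fsetP/(_ x)]; rewrite !inE xr orbT (negPf xr') orbF.
  by move: x_uve; rewrite !inE => /orP[/orP[]|] /eqP ->; rewrite ?(negPf ut) ?(negPf vt) ?(negPf et).
have disjX (r : {fset nat}) : (e \in r) || (eta `<=` r) ->
    [disjoint [fset s in X | ~~ (eta `<=` s)] & [fset s `|` r | s in L]].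
  move=> er; apply/fdisjointP => s; rewrite !inE => /andP[sX eta_s].
  apply/imfsetP => -[t _ Es]; case/orP: er => [er|eta_r].
    by have := freshP eX sX; rewrite Es !inE er orbT.
  by case/negP: eta_s; rewrite Es; apply: fsubset_trans eta_r (fsubsetUr _ _).
have disjL (r : {fset nat}) : r `<=` [fset u; v; e] -> forall s, s \in L -> [disjoint s & r].
  move=> /fsubsetP r_uve s /Lnot[us vs es]; rewrite fdisjoint_sym; apply/fdisjointP => x /r_uve.
  by rewrite !inE => /orP[/orP[]|] /eqP ->.
have cards2n (x y : nat) : x != y -> #|` [fset x; y]| = 2 by move=> xy; rewrite cardfs2 xy.
have eu' : u != e by rewrite eq_sym.
have ev' : v != e by rewrite eq_sym.
have sub_uve (r : {fset nat}) : r \in [:: eta; [fset e]; [fset u; e]; [fset v; e]] ->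
    r `<=` [fset u; v; e].
  rewrite !inE => /or4P[] /eqP ->; rewrite /eta; apply/fsubsetP => x; rewrite !inE;
    do ?[case/orP]; by move=> ->; rewrite ?orbT.
rewrite EY !face_sumU; first last.
- by rewrite !fdisjointXU !disjX // !inE ?eqxx ?orbT.
- rewrite fdisjointXU fdisjoint_sym (disj_join _ _ u) ?inE ?eqxx ?orbT ?(negPf eu') //=.
  by rewrite fdisjoint_sym (disj_join _ _ v) ?inE ?eqxx ?orbT ?(negPf ev').
- by rewrite (disj_join _ _ u) // !inE ?eqxx ?orbT // negb_or uv.
rewrite !face_sum_join; try by apply: disjL; apply: sub_uve; rewrite !inE eqxx ?orbT.
rewrite [in RHS]EX face_sumU ?disjX ?fsubset_refl ?orbT // face_sum_join; last first.
  by apply: disjL; apply: sub_uve; rewrite !inE eqxx.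
rewrite cardfs1 !cards2n //.
rewrite -!addrA; congr (_ + _)%R; rewrite -!big_split /=.
by apply: eq_bigr => t _; rewrite addn1 addn2 addrCA.
Qed.

End FaceSums.

Definition cross_face (a b : seq nat) (s : {fset nat}) : Prop :=
  (forall v, v \in s -> v \in a ++ b) /\
  (forall i, i < size a -> ~ (nth 0 a i \in s /\ nth 0 b i \in s)).

Lemma cross_face_cons (x y : nat) (a b : seq nat) (s : {fset nat}) :
  cross_face (x :: a) (y :: b) s <->
  [/\ forall v, v \in s -> v \in [:: x, y & a ++ b], ~ (x \in s /\ y \in s) &
    forall i, i < size a -> ~ (nth 0 a i \in s /\ nth 0 b i \in s)].
Proof.
have mem_cons v : (v \in (x :: a) ++ (y :: b)) = (v \in [:: x, y & a ++ b]).
  by rewrite /= !inE !mem_cat !inE; congr (_ || _); rewrite orbCA.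
split=> [[vs ns]|[vs n0 ns]].
  split=> [v /vs|//|i]; [by rewrite mem_cons|exact: (ns 0)|exact: (ns i.+1)].
by split=> [v /vs|[|i]]; [rewrite mem_cons|move=> _; exact: n0|exact: ns].
Qed.

(** A face contains neither [x] nor [y], only [x], or only [y]; the last two families shift [j] by
    one, as in the recursion of [cross_sum]. *)
Lemma face_sum_cross_polytope (V : zmodType) (F : nat -> V) (Y : complex) (a b : seq nat) (j : nat) :
  size a = size b -> uniq (a ++ b) -> (forall s, s \in Y <-> cross_face a b s) ->
  (\sum_(s <- Y) F (#|` s| + j)%N)%R = cross_sum F (size a) j.
Proof.
elim: a b Y j => [|x a IHa] [|y b] //= Y j.
  move=> _ _ Y_cross; have -> : Y = [fset fset0].
    apply/fsetP => s; rewrite inE; apply/idP/eqP => [/Y_cross[s0 _]|->].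
      by apply/fsetP => v; rewrite in_fset0; apply/negP => /s0.
    by apply/Y_cross; split=> // v; rewrite inE.
  by rewrite big_seq_fset1 cardfs0.
move=> [ab_size] /andP[]; rewrite mem_cat inE !negb_or => /and3P[xa xy xb].
rewrite -cat1s uniq_catCA cat1s /= mem_cat negb_or => /andP[/andP[ya yb]] ab_uniq Y_cross.
pose Y' := [fset s in Y | (x \notin s) && (y \notin s)].
have Y'_cross s : s \in Y' <-> cross_face a b s.
  rewrite !inE /=; split=> [/and3P[/Y_cross/cross_face_cons[vs _ ns] xs ys]|[vs ns]].
    split=> // v v_s; have := vs v v_s; rewrite !inE => /orP[/eqP vx|/orP[/eqP vy|//]].
      by rewrite -vx v_s in xs.
    by rewrite -vy v_s in ys.
  have xs : x \notin s by apply/negP => /vs; rewrite mem_cat (negPf xa) (negPf xb).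
  have ys : y \notin s by apply/negP => /vs; rewrite mem_cat (negPf ya) (negPf yb).
  rewrite xs ys !andbT; apply/Y_cross/cross_face_cons; split=> //.
    by move=> v /vs; rewrite !inE => ->; rewrite !orbT.
  by move=> [xs']; rewrite xs' in xs.
have Y'_not s : s \in Y' -> (x \notin s) && (y \notin s) by rewrite !inE => /andP[].
have disj z s : z \in [:: x; y] -> s \in Y' -> [disjoint s & [fset z]].
  move=> z_xy /Y'_not/andP[xs ys]; rewrite fdisjoint_sym; apply/fdisjointP => w.
  by rewrite inE => /eqP ->; move: z_xy; rewrite !inE => /orP[] /eqP ->.
have joinY z s : z \in [:: x; y] -> s \in Y' -> s `|` [fset z] \in Y.
  move=> z_xy sY'; have /andP[xs ys] := Y'_not s sY'; have /Y'_cross[vs ns] := sY'.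
  have z_ab : z \notin a ++ b.
    by move: z_xy; rewrite !inE mem_cat negb_or => /orP[] /eqP ->; apply/andP.
  apply/Y_cross/cross_face_cons; split.
  - move=> v; rewrite !inE => /orP[/vs ->|/eqP ->]; first by rewrite !orbT.
    by move: z_xy; rewrite !inE => /orP[] ->; rewrite ?orbT.
  - move=> []; rewrite !inE (negPf xs) (negPf ys) /= => /eqP xz /eqP yz.
    by rewrite xz yz eqxx in xy.
  - move=> i i_a; rewrite !inE => -[].
    have /negPf -> : nth 0 a i != z.
      by apply: contraNneq z_ab => <-; rewrite mem_cat mem_nth.
    have /negPf -> : nth 0 b i != z.
      by apply: contraNneq z_ab => <-; rewrite mem_cat mem_nth ?orbT // -ab_size.
    by rewrite !orbF => si si'; apply: (ns i i_a).
have EY : Y = Y' `|` ([fset s `|` [fset x] | s in Y'] `|` [fset s `|` [fset y] | s in Y']).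
  apply/fsetP => s; rewrite !in_fsetU; apply/idP/idP => [sY|]; last first.
    case/orP=> [|/orP[] /imfsetP[t tY' ->]]; first by rewrite !inE => /andP[].
      by apply: joinY => //; rewrite !inE eqxx.
    by apply: joinY => //; rewrite !inE eqxx orbT.
  have /Y_cross/cross_face_cons[vs nxy ns] := sY.
  have Y'D z : z \in [:: x; y] -> z \in s -> s `\ z \in Y'.
    move=> z_xy zs; apply/Y'_cross; split=> [v|i i_a]; last first.
      by rewrite !inE => -[/andP[_ ?] /andP[_ ?]]; apply: (ns i i_a).
    rewrite !inE => /andP[v_z v_s]; have := vs v v_s; rewrite !inE.
    case/orP=> [/eqP vx|/orP[/eqP vy|//]]; case: nxy; split; rewrite -?vx -?vy //.
      by move: z_xy v_z zs; rewrite vx !inE => /orP[] /eqP ->; rewrite ?eqxx.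
    by move: z_xy v_z zs; rewrite vy !inE => /orP[] /eqP ->; rewrite ?eqxx.
  have [xs|xs] := boolP (x \in s).
    apply/or3P/Or32/imfsetP; exists (s `\ x); first by apply: Y'D; rewrite // !inE eqxx.
    by rewrite fsetUC fsetD1K.
  have [ys|ys] := boolP (y \in s).
    apply/or3P/Or33/imfsetP; exists (s `\ y); first by apply: Y'D; rewrite // !inE eqxx orbT.
    by rewrite fsetUC fsetD1K.
  by apply/orP; left; rewrite !inE sY xs ys.
pose G n := F (n + j)%N.
rewrite -[LHS]/(face_sum G Y) EY !face_sumU; last first.
- rewrite fdisjointXU; apply/andP; split; apply/fdisjointP => s /Y'_not/andP[xs ys].
    by apply: contra xs => /imfsetP[t _ ->]; rewrite !inE eqxx orbT.
  by apply: contra ys => /imfsetP[t _ ->]; rewrite !inE eqxx orbT.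
- apply/fdisjointP => _ /imfsetP[s /= sY' ->]; apply/imfsetP => -[t /= /Y'_not/andP[xt _]].
  by move=> /fsetP/(_ x); rewrite !inE eqxx orbT (negPf xt) (negPf xy).
rewrite !face_sum_join; last first.
- by move=> s; apply: disj; rewrite !inE eqxx.
- by move=> s; apply: disj; rewrite !inE eqxx orbT.
rewrite !cardfs1 /face_sum /G (IHa b Y' j) //.
under eq_bigr do rewrite -addnA add1n.
by rewrite (IHa b Y' j.+1) // mulr2n.
Qed.

Lemma is_edgeP (X : complex) (eta : {fset nat}) : is_edge X eta ->
  eta \in X /\ exists u v, u != v /\ eta = [fset u; v].
Proof.
move=> /andP[etaX]; split=> //.
have: #|` eta| = 2 by apply/eqP.
have := fset_uniq eta; have : forall x, (x \in eta) = (x \in enum_fset eta) by [].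
case: (enum_fset eta) => [|u [|v [|]]] //= mem_eta; rewrite inE andbT => uv _.
by exists u, v; split=> //; apply/fsetP => x; rewrite mem_eta !inE.
Qed.

Lemma new_edge_in_edge_sub (X : complex) (u v e w : nat) :
  (forall s t, s \in X -> t `<=` s -> t \in X) -> u != v -> fresh X e ->
  [fset u; v] \in X -> w \in [fset u; v] ->
  [fset e; w] \in edge_sub X [fset u; v] e.
Proof.
move=> X_closed uv eX etaX w_uv; have /andP[eu ev] := fresh_edge eX etaX.
rewrite in_edge_sub // fset21; apply/andP; split.
  suff -> : [fset e; w] `\ e `|` [fset u; v] = [fset u; v] by [].
  apply/fsetP => x; rewrite in_fsetU in_fsetD1 in_fset2.
  have [->|_] := eqVneq x w; first by rewrite w_uv orbT.
  by case: (x == e).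
rewrite fsubset_edge !in_fset2 ![_ == e]eq_sym (negPf eu) (negPf ev) /=.
by apply/negP => /andP[/eqP uw /eqP vw]; rewrite uw vw eqxx in uv.
Qed.

Lemma hpoly_msub (n : nat) (X : complex) (eta : {fset nat}) (m : nat) (Y : complex)
    (eps : {fset nat}) (e : nat) :
  is_simplicial_complex X -> is_edge X eta -> msub X eta m Y eps e ->
  hpoly n Y = (hpoly n X + (\sum_(s <- link X eta) edge_term n #|` s|) *+ m)%R.
Proof.
move=> [_ X_closed] eta_edge Y_sub.
(* The induction also carries the fact that every edge eligible for the next step has the link of
   [eta]. *)
suff [] : [/\ forall s t, s \in Y -> t `<=` s -> t \in Y, e \notin eps,
    forall w, w \in eps -> [fset e; w] \in Y /\ link Y [fset e; w] = link X eta &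
    hpoly n Y = (hpoly n X + (\sum_(s <- link X eta) edge_term n #|` s|) *+ m)%R] by [].
elim: Y_sub => {m Y eps e} [e eX|m Y eps e u e' _ [Y_closed e_eps new_edge EY] u_eps e'Y].
  have [etaX [u [v [uv Eeta]]]] := is_edgeP eta_edge; rewrite Eeta in etaX *.
  have /andP[eu ev] := fresh_edge eX etaX.
  split.
  - by move=> s t; apply: edge_sub_closed.
  - by rewrite !inE negb_or eu.
  - by move=> w w_eta; rewrite new_edge_in_edge_sub // link_edge_sub.
  - by rewrite mulr1n; apply: face_sum_edge_sub.
have [euY link_eu] := new_edge u u_eps.
have eu : e != u by apply: contraNneq e_eps => ->.
have /andP[e'e e'u] := fresh_edge e'Y euY.
split.
- by move=> s t; apply: edge_sub_closed.
- by rewrite !inE negb_or e'e.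
- by move=> w w_eta; rewrite new_edge_in_edge_sub // link_edge_sub.
- by rewrite mulrS [(_ + _ *+ m)%R]addrC addrA -EY -link_eu; apply: face_sum_edge_sub.
Qed.

Lemma sum_link_cross_polytope (n : nat) (L : complex) : is_cross_polytope L ->
  exists a b : seq nat, [/\ size a = size b, uniq (a ++ b),
    forall s, s \in L <-> cross_face a b s &
    (\sum_(s <- L) edge_term n #|` s|)%R = cross_sum (edge_term n) (size a) 0].
Proof.
move=> [a [b [ab_size [ab_uniq L_cross]]]]; exists a, b; split=> //.
rewrite -(face_sum_cross_polytope _ _ ab_size ab_uniq L_cross).
by under [RHS]eq_bigr do rewrite addn0.
Qed.

Local Close Scope fset_scope.
Local Open Scope ring_scope.

(** * Edges with a small link *)

Local Notation RR := Rdefinitions.R.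

(** Barycentric coordinates are extended by 0 to all numbers, because [x] and [y] below need not be
    vertices. *)
Definition bary (n : nat) (p : 'rV[RR]_n) (w : nat) : RR :=
  if insub w is Some i then p 0 i else 0.

Lemma bary_ord n (p : 'rV[RR]_n) (i : 'I_n) : bary p i = p 0 i.
Proof. by rewrite /bary valK. Qed.

Lemma bary_eq0 n (p : 'rV[RR]_n) w : (n <= w)%N -> bary p w = 0.
Proof. by move=> n_w; rewrite /bary insubN // -leqNgt. Qed.

Lemma bary_continuous n w : continuous (fun p : 'rV[RR]_n => bary p w).
Proof.
rewrite /bary; case: insub => [i|]; last exact: cst_continuous.
exact: coord_continuous.
Qed.

Lemma sum_bary n (p : 'rV[RR]_n) w : \sum_(i < n) bary p w * (val i == w)%:R = bary p w.
Proof.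
have [w_lt|w_ge] := ltnP w n; last by rewrite bary_eq0 // big1 // => i _; rewrite mul0r.
rewrite (bigD1 (Ordinal w_lt)) //= eqxx mulr1 big1 ?addr0 // => i /eqP i_w.
by case: eqP => [i_eq|_]; [case: i_w; apply: val_inj|rewrite mulr0].
Qed.

Lemma ltn_vbound (X : complex) (s : {fset nat}) x :
  s \in X -> x \in s -> (x < vbound X)%N.
Proof.
move=> sX xs; apply: leq_trans (@leq_bigmax_seq _ _ xpredT (fun s : {fset nat} => \max_(x <- s) x.+1)%N s sX isT).
exact: (@leq_bigmax_seq _ _ xpredT (fun x => x.+1) x xs isT).
Qed.

Lemma continuous_sub (R : realType) (T : topologicalType) (f1 f2 : T -> R) :
  continuous f1 -> continuous f2 -> continuous (fun z => f1 z - f2 z).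
Proof. by move=> f1_cont f2_cont z; apply: cvgB; [exact: f1_cont|exact: f2_cont]. Qed.

(** * Edges contained in at most two triangles *)

Section ThinStar.
Variables (X : complex) (u v x y : nat).
Hypotheses (X_closed : forall s t, s \in X -> (t `<=` s)%fset -> t \in X)
           (uv_in : [fset u; v]%fset \in X) (uvxy : uniq [:: u; v; x; y])
           (star : forall s, s \in X -> u \in s -> v \in s ->
              ~ (x \in s /\ y \in s) /\ (s `<=` [fset u; v; x; y])%fset).

Lemma star_bary (p : 'rV[RR]_(vbound X)) :
  realization X p -> 0 < bary p u -> 0 < bary p v ->
  [/\ forall i, p 0 i = bary p u * (val i == u)%:R + bary p v * (val i == v)%:R
        + bary p x * (val i == x)%:R + bary p y * (val i == y)%:R,
      bary p u + bary p v + bary p x + bary p y = 1,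
      0 <= bary p x, 0 <= bary p y & bary p x = 0 \/ bary p y = 0].
Proof.
move=> [s sX [p0 p_ge0 p1]] u_gt0 v_gt0.
have bary_ge0 w : 0 <= bary p w by rewrite /bary; case: insub.
have bary_in w : bary p w != 0 -> w \in s.
  apply: contraR => ws; rewrite /bary; case: insubP => // i _ Ei.
  by rewrite p0 // Ei.
have us : u \in s by apply: bary_in; rewrite gt_eqF.
have vs : v \in s by apply: bary_in; rewrite gt_eqF.
have [nxy /fsubsetP s_sub] := star sX us vs.
have decomp i : p 0 i = bary p u * (val i == u)%:R + bary p v * (val i == v)%:R
        + bary p x * (val i == x)%:R + bary p y * (val i == y)%:R.
  have [i_s|/p0 pi0] := boolP (val i \in s).
    have := s_sub _ i_s; move: uvxy; rewrite -bary_ord /= !inE !negb_or => /and4P[].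
    move=> /and3P[/negPf uv /negPf ux /negPf uy] /andP[/negPf vx /negPf vy] /negPf xy _.
    have vu := uv; have xu := ux; have yu := uy; have xv := vx; have yv := vy; have yx := xy.
    rewrite eq_sym in vu; rewrite eq_sym in xu; rewrite eq_sym in yu.
    rewrite eq_sym in xv; rewrite eq_sym in yv; rewrite eq_sym in yx.
    move=> /orP[/orP[/orP[]|]|] /eqP ->;
      by rewrite eqxx ?uv ?ux ?uy ?vx ?vy ?xy ?vu ?xu ?yu ?xv ?yv ?yx !mulr0 mulr1 ?addr0 ?add0r.
  have E w : bary p w * (val i == w)%:R = 0.
    by case: eqP => [<-|_]; rewrite ?mulr0 // bary_ord pi0 mul0r.
  by rewrite pi0 !E !addr0.
split=> //.
  rewrite -p1 [RHS]big_mkcond /=.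
  have -> : \sum_(i < vbound X) (if val i \in s then p 0 i else 0) = \sum_(i < vbound X) p 0 i.
    by apply: eq_bigr => i _; case: ifPn => // /p0.
  by rewrite (eq_bigr _ (fun i _ => decomp i)) !big_split /= !sum_bary.
have [->|/bary_in xs] := eqVneq (bary p x) 0; first by left.
by right; apply/eqP; apply: contrapT => /negP/bary_in ys; apply: nxy.
Qed.

(* On the open star of [{u, v}], [p_u] and [p_x - p_y] determine the point [p]. *)
Lemma star_bary_inj (p q : 'rV[RR]_(vbound X)) :
  realization X p -> 0 < bary p u -> 0 < bary p v ->
  realization X q -> 0 < bary q u -> 0 < bary q v ->
  bary p u = bary q u -> bary p x - bary p y = bary q x - bary q y -> p = q.
Proof.
move=> Xp pu pv Xq qu qv Eu Exy.
have [decp sump px py pxy] := star_bary Xp pu pv.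
have [decq sumq qx qy qxy] := star_bary Xq qu qv.
(* Both coordinates are nonnegative and one is 0, so they are the positive and negative parts of
   their difference. *)
have [Ex Ey] : bary p x = bary q x /\ bary p y = bary q y.
  by case: pxy => pxy; case: qxy => qxy; lra.
have Ev : bary p v = bary q v by lra.
by apply/rowP => i; rewrite decp decq Eu Ev Ex Ey.
Qed.

(** A chart around the image of the midpoint of the edge carries a neighbourhood of 0 in 3-space
    injectively into the open star, hence into the plane, against [no_local_embedding]. *)
Lemma not_triangulates_sphere : ~ triangulates_sphere X 5.
Proof.
move=> [_ [f [g [_ g_cont f_sphere g_real [gf fg]]]]].
have uv : u != v by move: uvxy; rewrite /= inE negb_or => /andP[/andP[]].
have u_lt : (u < vbound X)%N by apply: (ltn_vbound uv_in); rewrite !inE eqxx.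
have v_lt : (v < vbound X)%N by apply: (ltn_vbound uv_in); rewrite !inE eqxx orbT.
pose iu := Ordinal u_lt; pose iv := Ordinal v_lt.
pose mid : 'rV[RR]_(vbound X) := \row_i (((val i == u) || (val i == v))%:R / 2).
have mid_u : bary mid u = 2^-1 by rewrite -[u]/(val iu) bary_ord mxE eqxx div1r.
have mid_v : bary mid v = 2^-1 by rewrite -[v]/(val iv) bary_ord mxE eqxx orbT div1r.
have mid_real : realization X mid.
  exists [fset u; v]%fset => //; split=> [i|i|].
  - by rewrite mxE !inE => /negPf ->; rewrite mul0r.
  - by rewrite mxE divr_ge0 ?ler0n.
  rewrite (bigD1 iu) ?inE ?eqxx //= (bigD1 iv) /=; last first.
    by rewrite !inE eqxx orbT -val_eqE /= eq_sym.
  rewrite big1 ?addr0 => [|i]; last first.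
    by rewrite !inE -!val_eqE /= => /andP[/andP[/orP[]-> //=]]; rewrite ?andbF.
  by rewrite !mxE /= !eqxx orbT -splitr.
have [c [c_cont c_sphere c0 c_inj]] := sphere_chart (f_sphere _ mid_real).
pose K z := g (c z).
have K_cont : continuous K.
  (* [g] is continuous only within the sphere, but [c] never leaves it. *)
  move=> z; apply: (@cvg_comp _ _ _ c g _ (within (sphere 5) (nbhs (c z)))).
    by move=> A /= /(c_cont z); apply: (@filterS _ (nbhs z)) => z' /=; apply; apply: c_sphere.
  by move/subspace_continuousP : g_cont; apply; apply: c_sphere.
have baryK_cont w : continuous (fun z => bary (K z) w).
  move=> z; apply: (@continuous_comp _ _ _ K (fun p => bary p w));
    by [exact: K_cont|exact: bary_continuous].
have K_real z : realization X (K z) by apply: g_real; apply: c_sphere.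
have K0 : K 0 = mid by rewrite /K c0 gf.
pose U : set (RR * RR * RR) := [set z | 0 < bary (K z) u /\ 0 < bary (K z) v]%classic.
have U_nbhs : nbhs (0 : RR * RR * RR) U.
  have pos w : bary mid w = 2^-1 -> nbhs (0 : RR * RR * RR) [set z | 0 < bary (K z) w]%classic.
    move=> mid_w; apply: (baryK_cont w 0 [set r | 0 < r]%classic).
    by apply: lt_nbhsr; rewrite K0 mid_w invr_gt0.
  exact: filterI (pos u mid_u) (pos v mid_v).
have xy_cont : continuous (fun z => bary (K z) x - bary (K z) y).
  exact: (@continuous_sub RR _ _ _ (baryK_cont x) (baryK_cont y)).
apply: (no_local_embedding (baryK_cont u) xy_cont U_nbhs) => z z' [zu zv] [z'u z'v] Eu Exy.
have EK : K z = K z' by apply: star_bary_inj.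
apply: c_inj.
exact: etrans (esym (fg _ (c_sphere z))) (etrans (congr1 f EK) (fg _ (c_sphere z'))).
Qed.

End ThinStar.

(** With no pair the edge is a maximal face, and with one pair it lies in exactly two triangles;
    both are cases of a thin star. *)
Lemma link_cross_polytope_ge2 (X : complex) (eta : {fset nat}) (a b : seq nat) :
  triangulates_sphere X 5 -> is_edge X eta -> size a = size b -> uniq (a ++ b) ->
  (forall s, s \in link X eta <-> cross_face a b s) -> (2 <= size a)%N.
Proof.
move=> X_sphere /is_edgeP[etaX [u [v [uv Eeta]]]] ab_size ab_uniq L_cross.
have [[_ X_closed] _] := X_sphere.
rewrite {}Eeta in etaX L_cross.
rewrite leqNgt; apply/negP => a_small.
suff [x [y [uvxy star]]] : exists x y, uniq [:: u; v; x; y] /\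
    forall s, s \in X -> u \in s -> v \in s ->
      ~ (x \in s /\ y \in s) /\ (s `<=` [fset u; v; x; y])%fset.
  exact: (@not_triangulates_sphere X u v x y).
have starP s : s \in X -> u \in s -> v \in s -> cross_face a b (s `\` [fset u; v])%fset.
  move=> sX us vs; apply/L_cross/(link_edgeP u v X_closed); rewrite !inE !eqxx ?orbT /=; split=> //.
  suff -> : (s `\` [fset u; v] `|` [fset u; v])%fset = s by [].
  apply/fsetP => w; rewrite !inE; have [->|_] := eqVneq w u; first by rewrite us ?orbT.
  by have [->|_] := eqVneq w v; rewrite ?vs ?orbF.
case: a b ab_size ab_uniq L_cross starP a_small => [|x [|x' a]] // [|y [|y' b]] //= _.
  (* no third vertex: [x] and [y] are arbitrary numbers outside the edge *)
  move=> _ _ starP _; exists (u + v).+1, (u + v).+2; split.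
    by rewrite /= !inE; lia.
  move=> s sX us vs; have [s_uv _] := starP s sX us vs.
  have s_sub w : w \in s -> (w == u) || (w == v).
    by move=> ws; apply: contrapT => /negP w_uv; have := s_uv w; rewrite !inE w_uv ws => /(_ isT).
  split=> [[/s_sub + _]|]; first by lia.
  by apply/fsubsetP => w /s_sub; rewrite !inE => /orP[] ->; rewrite ?orbT.
rewrite inE andbT => xy L_cross starP _; exists x, y.
have vertex z : z \in [:: x; y] -> [fset z]%fset \in link X [fset u; v]%fset.
  move=> z_xy; apply/L_cross; split=> [w|[|i]] //=; first by rewrite inE => /eqP ->.
  by move=> _ []; rewrite !inE => /eqP <- /eqP yx; rewrite yx eqxx in xy.
have notin z : z \in [:: x; y] -> (z != u) && (z != v).
  by move=> /vertex/(link_edgeP u v X_closed)[_]; rewrite !inE ![_ == z]eq_sym => -> ->.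
have /andP[xu xv] : (x != u) && (x != v) by apply: notin; rewrite !inE eqxx.
have /andP[yu yv] : (y != u) && (y != v) by apply: notin; rewrite !inE eqxx orbT.
split.
  by rewrite /= !inE !negb_or uv xy ![u == _]eq_sym ![v == _]eq_sym xu xv yu yv.
move=> s sX us vs; have [s_xy nxy] := starP s sX us vs; split.
  by move=> [xs ys]; apply: (nxy 0); rewrite //= !inE xs ys !negb_or xu xv yu yv.
apply/fsubsetP => w ws; rewrite !inE -!orbA.
have [//|/= wu] := eqVneq w u; have [//|/= wv] := eqVneq w v.
by have := s_xy w; rewrite !inE negb_or wu wv ws => /(_ isT).
Qed.

Theorem theorem3p3p3 (X : complex) (eta : {fset nat}) :
  triangulates_sphere X 5 ->
  is_flag X ->
  is_edge X eta ->
  is_cross_polytope (link X eta) ->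
  (hpoly 6 X).[-1] < 0 ->
  exists M : nat, forall (m : nat) (Y : complex) (eps : {fset nat}) (e : nat),
    (M <= m)%N -> msub X eta m Y eps e -> has_nonreal_root (hpoly 6 Y).
Proof.
move=> X_sphere _ eta_edge link_cross hX_lt0.
have [a [b [ab_size ab_uniq L_cross link_sum]]] := sum_link_cross_polytope 6 link_cross.
have a_ge2 := link_cross_polytope_ge2 X_sphere eta_edge ab_size ab_uniq L_cross.
have [M nonreal] := nonreal_root_cross_sum a_ge2 hX_lt0.
exists M => m Y eps e /nonreal + Y_sub.
by rewrite -link_sum -(hpoly_msub 6 (proj1 X_sphere) eta_edge Y_sub).
Qed.
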